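(* Let $G$ be a discrete group containing (as a subgroup) the free group $F_\infty$ on infinitely many generators. If $G$ has the approximation property (AP), then there exists a multiplier $u\in MA(G)$ for which the map $S_u$ is compact but not completely compact.
   Context: $G$ is a discrete group, $\lambda^0$ its left regular representation on $\ell^2(G)$, $C_r^*(G)$ its reduced C*-algebra, $\mathrm{VN}(G)$ its von Neumann algebra. $A(G)$ is the Fourier algebra of $G$ (functions $s\mapsto(\lambda^0_s\xi,\eta)$, $\xi,\eta\in\ell^2(G)$), viewed as the operator space predual of $\mathrm{VN}(G)$. $MA(G)$ is the algebra of functions $u:G\to\mathbb{C}$ with $uA(G)\subseteq A(G)$. For $u\in MA(G)$, $S_u:C_r^*(G)\to C_r^*(G)$ is the bounded map with $S_u(\lambda^0(f))=\lambda^0(uf)$, $f\in\ell^1(G)$. $M^{\rm cb}A(G)$ is the algebra of those $u\in MA(G)$ for which $v\mapsto uv$ is completely bounded on $A(G)$ (equivalently $S_u$ is completely bounded), normed by $\|u\|_{\rm m}=\|S_u\|_{\rm cb}$. The space $M^{\rm cb}A(G)$ is a dual Banach space (its canonical predual being the completion of $\ell^1(G)$ in the norm $\|f\|=\sup\{|\sum_s f(s)v(s)|:v\in M^{\rm cb}A(G),\|v\|_{\rm m}\le1\}$); $G$ has the (AP) if there is a net of finitely supported Herz-Schur multipliers (elements of $M^{\rm cb}A(G)$) converging to the constant function $1$ in the weak* topology of $M^{\rm cb}A(G)$. A map $\Psi:\mathcal{X}\to\mathcal{Z}$ between operator spaces is completely compact if it is completely bounded and for every $\epsilon>0$ there is a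 finite dimensional subspace $\mathcal{Y}\subseteq\mathcal{Z}$ such that $\mathrm{dist}(\Psi^{(m)}(x),M_m(\mathcal{Y}))<\epsilon$ for all $m\in\mathbb{N}$ and all $x\in M_m(\mathcal{X})$ with $\|x\|\le1$. *)

(* Defs.v *)
From HB Require Import structures.
From mathcomp Require Import all_boot all_order all_algebra.
From mathcomp Require Import finmap complex.
From mathcomp Require Import boolp classical_sets functions cardinality fsbigop.
From mathcomp Require Import reals ereal topology normedtype esum sequences.
From mathcomp Require Import ring.
From mathcomp Require summability.

Set Implicit Arguments.
Unset Strict Implicit.
Unset Printing Implicit Defensive.

Import Order.TTheory GRing.Theory Num.Theory.
Import numFieldNormedType.Exports.
Import ComplexField.

Local Open Scope classical_set_scope.
Local Open Scope complex_scope.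
Local Open Scope ring_scope.

Lemma esumZ (R : realType) (I : choiceType) (a : I -> \bar R) (r : R) :
  0 <= r -> (forall i, 0 <= a i)%E ->
  (\esum_(i in setT) (r%:E * a i) = r%:E * \esum_(i in setT) a i)%E.
Proof.
move=> r0 a0; rewrite /esum -ereal_supZl//; last first.
  by apply/set0P; eexists; exists set0 => //; split.
congr (ereal_sup _); apply/seteqP; split => [_ [A fA <-]|_ [_ [A fA <-] <-]].
- exists (\sum_(x \in A) a x)%E; first by exists A.
  by rewrite ge0_mule_fsumr.
- by exists A => //; rewrite ge0_mule_fsumr.
Qed.

Section SquareSum.
Variables (R : realType) (G : choiceType).
Local Notation C := R[i].
Implicit Types f g : G -> C.

Lemma normcE (z : C) : `|z| = (Normc.normc z)%:C.
Proof. by []. Qed.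

Lemma normc_ge0 (z : C) : 0 <= Normc.normc z.
Proof. by rewrite -lecR -normcE normr_ge0. Qed.

Lemma normcD (z w : C) : Normc.normc (z + w) <= Normc.normc z + Normc.normc w.
Proof. by rewrite -lecR rmorphD -!normcE ler_normD. Qed.

Definition sqsum f : \bar R := \esum_(s in setT) (Normc.normc (f s) ^+ 2)%:E.

Definition l2norm f : R := Num.sqrt (fine (sqsum f)).

Lemma sqsum_ge0 f : (0 <= sqsum f)%E.
Proof. by apply: esum_ge0 => s _; rewrite lee_fin sqr_ge0. Qed.

Lemma sqsum_fin f : (sqsum f < +oo)%E -> sqsum f = ((l2norm f) ^+ 2)%:E.
Proof.
move=> fo; rewrite /l2norm sqr_sqrtr ?fine_ge0 ?sqsum_ge0// fineK//.
by rewrite ge0_fin_numE ?sqsum_ge0.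
Qed.

Lemma l2norm_ge0 f : 0 <= l2norm f.
Proof. exact: sqrtr_ge0. Qed.

Lemma sqsumZ a f : sqsum (a *: f) = ((Normc.normc a ^+ 2)%:E * sqsum f)%E.
Proof.
rewrite /sqsum -esumZ ?sqr_ge0//; last by move=> s; rewrite lee_fin sqr_ge0.
by apply: eq_esum => s _; rewrite /GRing.scale/= Normc.normcM exprMn EFinM.
Qed.

Lemma sqsum_le f (r : R) : 0 <= r -> (sqsum f <= (r ^+ 2)%:E)%E ->
  l2norm f <= r.
Proof.
move=> r0 fr; rewrite -(@ler_pXn2r _ 2) ?nnegrE ?l2norm_ge0//.
by rewrite -lee_fin -sqsum_fin// (le_lt_trans fr)// ltry.
Qed.

Lemma sqsum_point f s : ((Normc.normc (f s) ^+ 2)%:E <= sqsum f)%E.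
Proof.
apply: esum_ge; exists [set s]; first by split => //; exact: finite_set1.
by rewrite fsbig_set1.
Qed.

Lemma sqsumDt f g (t : R) : 0 < t ->
  (sqsum (f + g)%R <= (1 + t)%:E * sqsum f + (1 + t^-1)%:E * sqsum g)%E.
Proof.
move=> t0; have ti0 : 0 < t^-1 by rewrite invr_gt0.
have t10 : 0 <= 1 + t by rewrite addr_ge0// ltW.
have ti10 : 0 <= 1 + t^-1 by rewrite addr_ge0// ltW.
have H (r : R) h : 0 <= r ->
    (r%:E * sqsum h = \esum_(s in setT) (r * Normc.normc (h s) ^+ 2)%:E)%E.
  by move=> r0; rewrite /sqsum -esumZ// => i; rewrite lee_fin sqr_ge0.
rewrite !H// -esumD; last 2 first.
- by move=> i _; rewrite lee_fin mulr_ge0// sqr_ge0.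
- by move=> i _; rewrite lee_fin mulr_ge0// sqr_ge0.
apply: le_esum => s _; rewrite -EFinD lee_fin.
apply: le_trans (_ : (Normc.normc (f s) + Normc.normc (g s)) ^+ 2 <= _).
  by rewrite ler_pXn2r ?nnegrE ?addr_ge0 ?normc_ge0 ?normcD.
move: (Normc.normc (f s) : R) (Normc.normc (g s) : R) => a b.
rewrite -subr_ge0.
rewrite (_ : _ - _ = t^-1 * (t * a - b) ^+ 2) ; last first.
  by field; rewrite gt_eqF.
by rewrite mulr_ge0 ?sqr_ge0// ltW.
Qed.

Lemma l2norm_eq0 f : (sqsum f < +oo)%E -> l2norm f = 0 -> f = 0.
Proof.
move=> fo f0; apply/funext => s; apply: Normc.eq0_normc.
have := sqsum_point f s; rewrite sqsum_fin// f0 expr0n/= lee_fin => h.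
by apply/eqP; rewrite -sqrf_eq0 eq_le h sqr_ge0.
Qed.

Lemma l2norm0 : l2norm 0 = 0.
Proof.
rewrite /l2norm /sqsum esum1 ?sqrtr0// => s _.
by rewrite Normc.normc0 expr0n.
Qed.

Lemma l2normD f g : (sqsum f < +oo)%E -> (sqsum g < +oo)%E ->
  l2norm (f + g) <= l2norm f + l2norm g.
Proof.
move=> fo go; have [f0|fn0] := eqVneq (l2norm f) 0.
  by rewrite (l2norm_eq0 fo f0) add0r l2norm0 add0r.
have [g0|gn0] := eqVneq (l2norm g) 0.
  by rewrite (l2norm_eq0 go g0) addr0 l2norm0 addr0.
apply: sqsum_le; first by rewrite addr_ge0 ?l2norm_ge0.
have f0 : 0 < l2norm f by rewrite lt0r fn0 l2norm_ge0.
have g0 : 0 < l2norm g by rewrite lt0r gn0 l2norm_ge0.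
have /le_trans := sqsumDt f g (divr_gt0 g0 f0); apply.
rewrite (sqsum_fin fo) (sqsum_fin go) -!EFinM -EFinD lee_fin le_eqVlt.
by apply/orP; left; apply/eqP; field; rewrite fn0 gn0.
Qed.


Lemma l2normZ a f : (sqsum f < +oo)%E ->
  l2norm (a *: f) = Normc.normc a * l2norm f.
Proof.
move=> fo; rewrite {1}/l2norm sqsumZ (sqsum_fin fo) -EFinM/= -exprMn.
by rewrite sqrtr_sqr ger0_norm// mulr_ge0 ?normc_ge0 ?l2norm_ge0.
Qed.

Definition l2pred : {pred G -> C} := [pred f | `[< (sqsum f < +oo)%E >]].

Lemma l2pred_submod : submod_closed l2pred.
Proof.
split.
  apply/asboolP; rewrite /sqsum esum1 ?ltry// => s _.
  by rewrite Normc.normc0 expr0n.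
move=> a f g /asboolP fo /asboolP go; apply/asboolP.
apply: le_lt_trans (sqsumDt _ _ ltr01) _.
by rewrite sqsumZ (sqsum_fin fo) (sqsum_fin go) -!EFinM -EFinD ltry.
Qed.

End SquareSum.

HB.instance Definition _ (R : realType) (G : choiceType) :=
  GRing.isSubmodClosed.Build R[i] (G -> R[i]) (@l2pred R G)
    (GRing.submod_closed_semi (@l2pred_submod R G)).

Record ell2 (R : realType) (G : choiceType) :=
  Ell2 { ell2_fun :> G -> R[i]; _ : ell2_fun \in l2pred (G := G) }.

HB.instance Definition _ (R : realType) (G : choiceType) :=
  [isSub for @ell2_fun R G].
HB.instance Definition _ (R : realType) (G : choiceType) :=
  [Choice of ell2 R G by <:].
HB.instance Definition _ (R : realType) (G : choiceType) :=
  [SubChoice_isSubLmodule of ell2 R G by <:].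

Section Ell2.
Variables (R : realType) (G : choiceType).
Local Notation C := R[i].
Implicit Types x y : ell2 R G.

Lemma ell2_fin x : (sqsum x < +oo)%E.
Proof. by case: x => f /= /asboolP. Qed.

Definition ell2norm x : C := (l2norm x)%:C.

Let normD x y : ell2norm (x + y) <= ell2norm x + ell2norm y.
Proof. by rewrite /ell2norm -rmorphD lecR l2normD ?ell2_fin. Qed.

Let normZ (a : C) x : ell2norm (a *: x) = `|a| * ell2norm x.
Proof. by rewrite /ell2norm normcE -rmorphM/= l2normZ ?ell2_fin. Qed.

Let norm_eq0 x : ell2norm x = 0 -> x = 0.
Proof.
by move=> /complexI x0; apply/val_inj/(l2norm_eq0 (ell2_fin x)).
Qed.

HB.instance Definition _ := Lmodule_isNormed.Build C (ell2 R G)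
  normD normZ norm_eq0.

End Ell2.

Section BoundedOperators.
Variables (R : realType) (V : normedModType R[i]).
Local Notation C := R[i].

Definition rnorm (W : normedModType C) (x : W) : R := complex.Re `|x|.

Lemma normE (W : normedModType C) (x : W) : `|x| = (rnorm x)%:C.
Proof.
have := normr_ge0 x; rewrite lecE/= => /andP[/eqP i0 _].
by rewrite /rnorm [LHS]complexE i0 mulr0 addr0.
Qed.

Lemma rnorm_ge0 (W : normedModType C) (x : W) : 0 <= rnorm x.
Proof. by rewrite -lecR -normE normr_ge0. Qed.

Lemma rnormD (W : normedModType C) (x y : W) :
  rnorm (x + y) <= rnorm x + rnorm y.
Proof. by rewrite -lecR rmorphD/= -!normE ler_normD. Qed.

Lemma rnormZ (W : normedModType C) (a : C) (x : W) :
  rnorm (a *: x) = Normc.normc a * rnorm x.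
Proof. by apply: complexI; rewrite rmorphM/= -!normE -normcE normrZ. Qed.

Lemma rnorm0 (W : normedModType C) : rnorm (0 : W) = 0.
Proof. by rewrite /rnorm normr0. Qed.

Definition bounded_op (T : V -> V) :=
  exists M : R, forall x, rnorm (T x) <= M * rnorm x.

Definition boppred : {pred V -> V} := [pred T | `[< linear T /\ bounded_op T >]].

Lemma boppred_submod : submod_closed boppred.
Proof.
split.
  apply/asboolP; split.
    by move=> a x y; rewrite /GRing.zero/= scaler0 addr0.
  by exists 0 => x; rewrite mul0r rnorm0.
move=> a S T /asboolP[lS [M bS]] /asboolP[lT [N bT]]; apply/asboolP; split.
  move=> b x y.
  rewrite !fctE lS lT !scalerDr !scalerA [b * a]mulrC.
  by rewrite addrACA.
exists (Normc.normc a * M + N) => x; rewrite !fctE.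
rewrite (le_trans (rnormD _ _))// mulrDl lerD ?bT// rnormZ -mulrA.
by rewrite ler_wpM2l// normc_ge0.
Qed.

HB.instance Definition _ := GRing.isSubmodClosed.Build C (V -> V) boppred
    (GRing.submod_closed_semi boppred_submod).

Record bop := Bop { bop_fun :> V -> V; _ : bop_fun \in boppred }.

HB.instance Definition _ := [isSub for bop_fun].
HB.instance Definition _ := [Choice of bop by <:].
HB.instance Definition _ := [SubChoice_isSubLmodule of bop by <:].

Implicit Types S T : bop.

Lemma bop_linear T : linear T.
Proof. by case: T => f /= /asboolP[]. Qed.

HB.instance Definition _ T := GRing.isLinear.Build C V V _ T (@bop_linear T).

Lemma bop_bounded T : bounded_op T.
Proof. by case: T => f /= /asboolP[]. Qed.

Definition opnorm T : R := sup [set rnorm (T x) | x in [set x | rnorm x <= 1]].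

Lemma opnorm_has_sup T :
  has_sup [set rnorm (T x) | x in [set x | rnorm x <= 1]].
Proof.
split; first by exists (rnorm (T 0)), 0 => //=; rewrite rnorm0.
have [M bM] := bop_bounded T; exists `|M| => _ [x /= x1 <-].
rewrite (le_trans (bM x))// (le_trans (ler_wpM2r (rnorm_ge0 x) (ler_norm M)))//.
by rewrite ler_piMr.
Qed.

Lemma opnorm_le1 T x : rnorm x <= 1 -> rnorm (T x) <= opnorm T.
Proof. by move=> x1; apply: sup_upper_bound; [exact: opnorm_has_sup|exists x]. Qed.

Lemma opnorm_ge0 T : 0 <= opnorm T.
Proof. by rewrite (le_trans (rnorm_ge0 (T 0)))// opnorm_le1// rnorm0. Qed.

Lemma opnormP T x : rnorm (T x) <= opnorm T * rnorm x.
Proof.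
have [x0|xn0] := eqVneq (rnorm x) 0.
  have [M bM] := bop_bounded T.
  by rewrite (le_trans (bM x))// x0 !mulr0.
have x0 : 0 < rnorm x by rewrite lt0r xn0 rnorm_ge0.
have nE : Normc.normc (rnorm x)^-1%:C = (rnorm x)^-1.
  by rewrite /= expr0n/= addr0 sqrtr_sqr ger0_norm// invr_ge0 ltW.
have : rnorm (T ((rnorm x)^-1%:C *: x)) <= opnorm T.
  by apply: opnorm_le1; rewrite rnormZ nE mulVf.
by rewrite linearZ rnormZ nE mulrC ler_pdivrMr.
Qed.

Lemma opnorm_le T (c : R) :
  (forall x, rnorm x <= 1 -> rnorm (T x) <= c) -> opnorm T <= c.
Proof.
move=> h; apply: ge_sup; first by case: (opnorm_has_sup T).
by move=> _ [x /= x1 <-]; exact: h.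
Qed.

Definition opnormc T : C := (opnorm T)%:C.

Let normD S T : opnormc (S + T) <= opnormc S + opnormc T.
Proof.
rewrite /opnormc -rmorphD lecR; apply: opnorm_le => x x1.
by rewrite (le_trans (rnormD _ _))// lerD// opnorm_le1.
Qed.

Let normZ (a : C) T : opnormc (a *: T) = `|a| * opnormc T.
Proof.
have le b S : opnorm (b *: S) <= Normc.normc b * opnorm S.
  apply: opnorm_le => x x1.
  by rewrite rnormZ ler_wpM2l ?normc_ge0// opnorm_le1.
rewrite /opnormc normcE -rmorphM/=; congr (_%:C); apply/eqP.
rewrite eq_le le/=; have [->|a0] := eqVneq a 0.
  by rewrite Normc.normc0 mul0r opnorm_ge0.
have na0 : 0 < Normc.normc a.
  by rewrite lt0r normc_ge0 andbT; apply: contra a0 => /eqP/Normc.eq0_normc ->.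
rewrite -ler_pdivlMl// -Normc.normcV.
by rewrite -{1}(scale1r T) -(mulVf a0) -scalerA le.
Qed.

Let norm_eq0 T : opnormc T = 0 -> T = 0.
Proof.
move=> /complexI T0; apply/val_inj/funext => x.
have := opnormP T x; rewrite T0 mul0r => Tx.
apply/eqP; rewrite -normr_eq0 normE; apply/eqP; congr (_%:C).
by apply/eqP; rewrite eq_le Tx rnorm_ge0.
Qed.

HB.instance Definition _ := Lmodule_isNormed.Build C bop normD normZ norm_eq0.

End BoundedOperators.

Section LeftRegular.
Variables (R : realType) (G : groupType).
Local Notation C := R[i].
Local Notation B := (bop (ell2 R G)).

Definition shift (s : G) (f : G -> C) : G -> C := fun t => f (s^-1 * t)%g.

Lemma sqsum_shift s f : sqsum (shift s f) = sqsum f.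
Proof.
apply/esym; rewrite /sqsum (@reindex_esum _ _ _ setT setT (fun t => s^-1 * t)%g)//.
  split => //; first by move=> x y _ _; exact: mulgI.
  by move=> y _; exists (s * y)%g => //; rewrite mulKg.
Qed.

Fact shift_l2 s (x : ell2 R G) : shift s x \in l2pred (G := G).
Proof. by apply/asboolP; rewrite sqsum_shift ell2_fin. Qed.

Definition ell2_shift s (x : ell2 R G) : ell2 R G := Ell2 (shift_l2 s x).

Fact ell2_shift_bop s : ell2_shift s \in boppred (V := ell2 R G).
Proof.
apply/asboolP; split; first by move=> a x y; apply/val_inj.
exists 1 => x; rewrite mul1r le_eqVlt; apply/orP; left; apply/eqP.
by rewrite /rnorm /Num.norm/= /l2norm sqsum_shift.
Qed.

Definition lreg s : B := Bop (ell2_shift_bop s).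

End LeftRegular.

Section OperatorSpaces.
Variable R : realType.
Local Notation C := R[i].

Definition l2sum (W : normedModType C) (I : finType) (x : I -> W) : R :=
  Num.sqrt (\sum_i rnorm (x i) ^+ 2).

Definition scalar_opnorm (I : finType) (a : I -> I -> C) : \bar R :=
  ereal_sup [set (l2sum (fun i => \sum_j a i j * x j : C^o))%:E
            | x in [set x : I -> C^o | l2sum x <= 1]].

(* The norm of T, acting on the Hilbert direct sum of m copies of V. *)
Definition bop_mxnorm (V : normedModType C) m (T : 'M[bop V]_m) : \bar R :=
  ereal_sup [set (l2sum (fun i => \sum_j T i j (x j)))%:E
            | x in [set x : 'I_m -> V | l2sum x <= 1]].

Definition matrix_norms (V : Type) := forall m : nat, 'M[V]_m -> \bar R.

(* An operator space is a set X in some ambient V, with norms on M_m(X). *)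
Section MapsBetweenOperatorSpaces.
Variables (V W : lmodType C) (NX : matrix_norms V) (NZ : matrix_norms W).
Variables (X : set V) (Z : set W) (Psi : V -> W).

Definition cb_norm : \bar R :=
  ereal_sup [set r | exists m (x : 'M[V]_m),
    [/\ forall i j, X (x i j), (NX x <= 1)%E & r = NZ (map_mx Psi x)]].

Definition completely_bounded := (cb_norm < +oo)%E.

Definition mxdist m (z : 'M[W]_m) (Y : set W) : \bar R :=
  ereal_inf [set NZ (z - y) | y in [set y : 'M[W]_m | forall i j, Y (y i j)]].

Definition fin_dim_subspace (Y : set W) :=
  exists n (b : 'I_n -> W), Y = [set \sum_i c i *: b i | c in [set: 'I_n -> C]].

Definition completely_compact :=
  completely_bounded /\
  forall eps : R, 0 < eps ->
    exists Y : set W, [/\ fin_dim_subspace Y, Y `<=` Z &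
      forall m (x : 'M[V]_m), (forall i j, X (x i j)) -> (NX x <= 1)%E ->
        (mxdist (map_mx Psi x) Y < eps%:E)%E].

End MapsBetweenOperatorSpaces.

Definition compact_on (V W : normedModType C) (X : set V) (Psi : V -> W) :=
  precompact (Psi @` [set x | X x /\ rnorm x <= 1]).

End OperatorSpaces.

Section GroupAlgebras.
Variables (R : realType) (G : groupType).
Local Notation C := R[i].
Local Notation H := (ell2 R G).
Local Notation B := (bop H).

Definition inner (x y : H) : C :=
  summability.sum (fun s => x s * (y s)^* : C^o).

Definition ell1 (f : G -> C) :=
  (\esum_(s in setT) (Normc.normc (f s))%:E < +oo)%E.

Definition lambda0 (f : G -> C) : B :=
  summability.sum (fun s => f s *: lreg R s).

Definition Cred : set B := closure [set lambda0 f | f in ell1].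

Definition commutant (A : set B) : set B :=
  [set T : B | forall S : B, A S -> forall x, T (S x) = S (T x)].

Definition VN : set B := commutant (commutant (range (@lreg R G))).

Definition coef (x y : H) : G -> C := fun s => inner (lreg R s x) y.

Definition fourier_algebra : set (G -> C) :=
  [set v | exists x y, v = coef x y].

Definition pmul (u v : G -> C) : G -> C := fun s => u s * v s.

Definition MA : set (G -> C) :=
  [set u | forall v, fourier_algebra v -> fourier_algebra (pmul u v)].

Definition is_multiplier_map (u : G -> C) (S : B -> B) :=
  [/\ forall T, Cred T -> Cred (S T),
      forall a T T', Cred T -> Cred T' -> S (a *: T + T') = a *: S T + S T',
      exists M : R, forall T, Cred T -> rnorm (S T) <= M * rnorm T &
      forall f, ell1 f -> S (lambda0 f) = lambda0 (pmul u f)].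

(* S_u is determined on Cred only; its values elsewhere are arbitrary. *)
Definition mult_map (u : G -> C) : B -> B := xget (fun=> 0) (is_multiplier_map u).

Definition mult_cb_norm (u : G -> C) : \bar R :=
  cb_norm (@bop_mxnorm R H) (@bop_mxnorm R H) Cred (mult_map u).

(* The duality (T, v) = (T x, y) for v = coef x y; when T is in VN it does *)
(* not depend on the choice of x and y.                                    *)
Definition VN_pairing (T : B) (v : G -> C) : C :=
  xget 0 [set z | exists x y, v = coef x y /\ z = inner (T x) y].

(* M_m(A(G)) is normed as a space of completely bounded maps VN -> M_m. *)
Definition fourier_mxnorm m (v : 'M[G -> C]_m) : \bar R :=
  ereal_sup [set r | exists n (T : 'M[B]_n),
    [/\ forall k l, VN (T k l), (bop_mxnorm T <= 1)%E &
        r = scalar_opnorm (fun p q : 'I_n * 'I_m =>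
              VN_pairing (T p.1 q.1) (v p.2 q.2))]].

Definition McbA : set (G -> C) :=
  [set u | MA u /\ completely_bounded fourier_mxnorm fourier_mxnorm
                     fourier_algebra (pmul u)].

Definition ell1_pairing (f v : G -> C) : C :=
  summability.sum (fun s => f s * v s : C^o).

Definition predual_norm (f : G -> C) : \bar R :=
  ereal_sup [set (Normc.normc (ell1_pairing f v))%:E
            | v in [set v | McbA v /\ (mult_cb_norm v <= 1)%E]].

(* The points of the predual of McbA, which is the completion of ell1 for *)
(* predual_norm, are represented by Cauchy sequences.                     *)
Definition predual_cauchy (f : nat -> G -> C) :=
  (forall n, ell1 (f n)) /\
  forall eps : R, 0 < eps -> exists N, forall m n, (N <= m)%N -> (N <= n)%N ->
    (predual_norm (f m - f n)%R < eps%:E)%E.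

Definition predual_eval (f : nat -> G -> C) (v : G -> C) : C :=
  lim ((fun n => ell1_pairing (f n) v : C^o) @ \oo).

Definition weakstar_cvg (I : Type) (le : I -> I -> Prop) (a : I -> G -> C)
    (v : G -> C) :=
  forall f, predual_cauchy f -> forall eps : R, 0 < eps ->
    exists i0, forall i, le i0 i ->
      Normc.normc (predual_eval f (a i) - predual_eval f v) < eps.

Definition directed (I : Type) (le : I -> I -> Prop) :=
  [/\ inhabited I, forall i, le i i,
      forall i j k, le i j -> le j k -> le i k &
      forall i j, exists k, le i k /\ le j k].

Definition has_AP :=
  exists (I : Type) (le : I -> I -> Prop) (a : I -> G -> C),
    [/\ directed le,
        forall i, McbA (a i) /\ finite_set [set s | a i s != 0] &
        weakstar_cvg le a (fun=> 1)].

End GroupAlgebras.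

Arguments Cred R G : clear implicits.
Arguments MA R G : clear implicits.
Arguments bop_mxnorm {R} V {m} T.

Definition free_on (X : Type) (F : groupType) (gen : X -> F) :=
  forall (K : groupType) (h : X -> K),
    (exists phi : {multiplicative F -> K}, forall x, phi (gen x) = h x) /\
    (forall phi psi : {multiplicative F -> K},
       (forall x, phi (gen x) = psi (gen x)) -> phi =1 psi).

Definition contains_free_infty (G : groupType) :=
  exists (F : groupType) (gen : nat -> F) (j : {multiplicative F -> G}),
    free_on gen /\ injective j.

(* Main.v *)
(* Let y_0, y_1, ... be the images in G of free generators and E the set of the
   products y_i y_j. The multiplier u is supported on E, with
   u(y_i y_j) = (max(i,j) + 1)^(-1/4) h(i,j), where h is the infinite Walsh
   matrix of signs.

   Haagerup's inequality: a function f supported on E convolves ell^2 to itself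
   with norm at most 3 |f|_2. Hence every v in A(G) is square summable on E,
   so that u v lies in ell^2, which is contained in A(G); moreover S_u T is the
   convolution by u . (T delta_1), and as |u| tends to 0 the image of the unit
   ball under S_u is contained in the continuous image of a ball of ell^2 with
   its (compact) topology of pointwise convergence.

   S_u is not completely bounded. With N = 2^k and c(i,j) = N^(-1/2) h(i,j), the
   matrix [c(i,j) lambda(y_i y_j)] with i, j < N has norm 1, because it is the
   orthogonal matrix c conjugated by unitaries; its image under S_u has norm at
   least N^(1/2) N^(-1/4), which is unbounded. *)

Require Import Defs.
From HB Require Import structures.
From mathcomp Require Import all_boot all_order all_algebra complex finmap.
From mathcomp Require Import boolp classical_sets functions cardinality fsbigop.
From mathcomp Require Import reals ereal topology normedtype esum sequences.
From mathcomp Require Import ring lra.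
From mathcomp Require summability.

Set Implicit Arguments.
Unset Strict Implicit.
Unset Printing Implicit Defensive.

Import Order.TTheory GRing.Theory Num.Theory.
Import numFieldNormedType.Exports.
Import ComplexField.

Local Open Scope classical_set_scope.
Local Open Scope card_scope.
Local Open Scope complex_scope.
Local Open Scope ring_scope.

(** * The group of permutations of a type *)

Record bijection (T : Type) := Bijection {
  bij_fun :> T -> T;
  bij_inv : T -> T;
  bij_funK : cancel bij_fun bij_inv;
  bij_invK : cancel bij_inv bij_fun }.

HB.instance Definition _ (T : Type) := gen_eqMixin (bijection T).
HB.instance Definition _ (T : Type) := gen_choiceMixin (bijection T).

Section BijectionGroup.
Variable T : Type.
Implicit Types p q r : bijection T.

Lemma bijectionP p q : p =1 q -> p = q.
Proof.
case: p q => f f' fK f'K [g g' gK g'K] /= /funext fg; rewrite -{}fg in gK g'K *.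
have g'E : g' = f' by apply/funext => x; rewrite -[x in LHS]f'K gK.
rewrite {}g'E in gK g'K *.
by congr Bijection; apply: Prop_irrelevance.
Qed.

Definition bij1 : bijection T := @Bijection T id id (frefl _) (frefl _).
Definition bijV p : bijection T := Bijection (@bij_invK _ p) (@bij_funK _ p).
Definition bijM p q : bijection T :=
  Bijection (can_comp (@bij_funK _ p) (@bij_funK _ q))
            (can_comp (@bij_invK _ q) (@bij_invK _ p)).

Lemma bijMA : associative bijM. Proof. by move=> p q r; apply: bijectionP. Qed.
Lemma bij1M : left_id bij1 bijM. Proof. by move=> p; apply: bijectionP. Qed.
Lemma bijM1 : right_id bij1 bijM. Proof. by move=> p; apply: bijectionP. Qed.
Lemma bijVM : left_inverse bij1 bijV bijM.
Proof. by move=> p; apply: bijectionP => x /=; rewrite bij_funK. Qed.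
Lemma bijMV : right_inverse bij1 bijV bijM.
Proof. by move=> p; apply: bijectionP => x /=; rewrite bij_invK. Qed.

HB.instance Definition _ :=
  isGroup.Build (bijection T) bijMA bij1M bijM1 bijVM bijMV.

End BijectionGroup.


(** * Ping-pong: a first-letter function on a group containing a free group *)

Lemma infinite_countable_bij (T : Type) (A : set T) :
  countable A -> infinite_set A -> A #= [set: nat].
Proof. by move=> cA /infiniteP iA; rewrite card_eq_le; apply/andP. Qed.



Section PingPong.

(** A signed letter [(i, b)] with a copy number; the copies make the class of each letter, and its
    complement, countably infinite. *)
Let point := (nat * bool * nat)%type.

(** Glued from two bijections between countably infinite sets: the complement of the class of
    [(i, false)] goes onto the class of [(i, true)], and the class of [(i, false)] onto the
    complement of the class of [(i, true)]. *)
Let pingpong_bijection (i : nat) : exists s : bijection point,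
  forall p, p.1 <> (i, false) -> (s p).1 = (i, true).
Proof.
pose L b : set point := [set p | p.1 = (i, b)].
have ic (D : set point) c : (forall k, D (c, k)) -> D #= [set: nat].
  move=> Dc; apply: infinite_countable_bij; first exact: countableP.
  move=> fD; apply: infinite_nat.
  suff -> : [set: nat] = pair c @^-1` D by apply: finite_preimage => // x y _ _ [].
  by apply/seteqP; split => k // _; exact: Dc.
have /card_set_bijP[f [fh fi fs]] : (~` L false) #= L true.
  apply: card_eq_trans (ic _ (i, true) _) _; first by move=> k [].
  by rewrite card_eq_sym; apply: (ic _ (i, true)).
have /card_set_bijP[g [gh gi gs]] : (L false) #= ~` L true.
  apply: card_eq_trans (ic _ (i, false) _) _ => //.
  by rewrite card_eq_sym; apply: (ic _ (i, false)) => k [].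
pose h p := if p.1 == (i, false) then g p else f p.
have hF p : p.1 <> (i, false) -> h p = f p by rewrite /h; case: eqP.
have hT p : p.1 = (i, false) -> h p = g p by rewrite /h; case: eqP.
have [h' hK h'K] : bijective h.
  rewrite -setTT_bijective; split => //.
    move=> p q _ _.
    have [pL|pL] := pselect (p.1 = (i, false)); [rewrite hT//|rewrite hF//];
    (have [qL|qL] := pselect (q.1 = (i, false)); [rewrite hT//|rewrite hF//]) => e.
    - by apply: gi e; rewrite inE.
    - by case: (gh _ pL); rewrite e; exact: fh.
    - by case: (gh _ qL); rewrite -e; exact: fh.
    - by apply: fi e; rewrite inE.
  move=> q _; have [qL|qL] := pselect (L true q).
    by have [p pL <-] := fs _ qL; exists p => //; rewrite hF.
  by have [p pL <-] := gs _ qL; exists p => //; rewrite hT.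
exists (Bijection hK h'K) => p pL /=; rewrite hF//; exact: fh.
Qed.

Local Open Scope group_scope.

(* [tau g] plays the role of the first letter of g, read in its coset of F;
   no normal form of the elements of F is needed. *)
Lemma contains_free_pingpong (G : groupType) : contains_free_infty G ->
  exists (y : nat -> G) (tau : G -> nat * bool),
    forall i g, tau g <> (i, false) -> tau (y i * g) = (i, true).
Proof.
move=> [F [gen [j [Ffree jinj]]]].
have j1 : j 1 = 1 by apply: (mulgI (j 1)); rewrite -gmulfM !mulg1.
have [s sP] := choice pingpong_bijection.
have [[phi phiE] _] := Ffree _ s.
(* Once a representative [r g] is fixed in each coset of [j F], [g = j (c g) * r g], and [c]
   commutes with left translation by [F]. *)
pose coset g := [set h | exists w : F, g = j w * h].
have cosetM w g : coset (j w * g) = coset g.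
  apply/seteqP; split => h [v e].
    exists (w^-1 * v); rewrite gmulfM -mulgA -e mulgA.
    by rewrite -[LHS]mul1g -j1 -(mulVg w) gmulfM.
  by exists (w * v); rewrite e gmulfM mulgA.
pose r g := xget 1 (coset g).
have rM w g : r (j w * g) = r g by rewrite /r cosetM.
have /choice[c cE] g : exists w, g = j w * r g.
  by rewrite /r; case: xgetP => [h -> //|/(_ g)[]]; exists 1; rewrite j1 mul1g.
have cM w g : c (j w * g) = w * c g.
  apply: jinj; apply: (mulIg (r g)).
  by rewrite -{1}(rM w g) -cE gmulfM -mulgA -cE.
(* [tau g] is the letter of the image of a base point under [phi (c g)]; the choice of base point is
   arbitrary. *)
exists (j \o gen), (fun g => ((phi (c g) : bijection point) ((0%N, true), 0%N)).1).
move=> i g /= tg; rewrite cM gmulfM phiE; exact: sP.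
Qed.

End PingPong.

(** * Sums of nonnegative extended reals *)

Section Esum.
Variable R : realType.
Local Open Scope ereal_scope.

Lemma exchange_esum (I J : choiceType) (a : I -> J -> \bar R) :
  (forall i j, 0 <= a i j) ->
  \esum_(i in setT) \esum_(j in setT) a i j =
  \esum_(j in setT) \esum_(i in setT) a i j.
Proof.
move=> a0; rewrite !esum_esum//.
rewrite (@reindex_esum _ _ _ ([set: J] `*`` fun=> [set: I])
  ([set: I] `*`` fun=> [set: J]) (fun p => (p.2, p.1)))//.
by split => // [[j i] [j' i'] _ _ /= [-> ->]//|[i j] _]; exists (j, i).
Qed.

Lemma esum_bij (I J : choiceType) (a : J -> \bar R) (e : I -> J) :
  bijective e -> \esum_(i in setT) a i = \esum_(i in setT) a (e i).
Proof. by move=> eb; apply: reindex_esum; rewrite setTT_bijective. Qed.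

Lemma esum_ge1 (I : choiceType) (a : I -> \bar R) i :
  (forall i, 0 <= a i) -> a i <= \esum_(i in setT) a i.
Proof.
move=> a0; apply: esum_ge.
by exists [set i]; [split => //; exact: finite_set1|rewrite fsbig_set1].
Qed.

Lemma esumZl (I : choiceType) (a : I -> \bar R) (r : \bar R) :
  0 <= r -> (forall i, 0 <= a i) ->
  \esum_(i in setT) (r * a i) = r * \esum_(i in setT) a i.
Proof.
case: r => [r| |]//; first by rewrite lee_fin; exact: esumZ.
(* For an infinite factor both sides are 0 or infinite, according to whether [a] vanishes
   identically. *)
move=> _ a0; have [[i ai]|aN] := pselect (exists i, 0 < a i); last first.
  have a00 i : a i = 0.
    by apply/eqP; apply: contra_notT aN => ai; exists i; rewrite lt0e ai a0.
  by rewrite !esum1 ?mule0// => i _; rewrite a00 mule0.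
rewrite gt0_mulye ?(lt_le_trans ai (esum_ge1 i a0))//.
apply/eqP; rewrite -leye_eq.
apply: le_trans (esum_ge1 (a := fun j => +oo * a j) i _); first by rewrite gt0_mulye.
by move=> j; rewrite mule_ge0.
Qed.

Lemma esumZr (I : choiceType) (a : I -> \bar R) (r : \bar R) :
  0 <= r -> (forall i, 0 <= a i) ->
  \esum_(i in setT) (a i * r) = (\esum_(i in setT) a i) * r.
Proof. by move=> *; under eq_esum do rewrite muleC; rewrite esumZl// muleC. Qed.

Lemma esum_single (I : choiceType) (a : I -> \bar R) i :
  0 <= a i -> (forall j, j != i -> a j = 0) -> \esum_(j in setT) a j = a i.
Proof.
move=> a0 ai; rewrite -[RHS]esum_set1//  [RHS]esum_mkcond; apply: eq_esum => j _.
case: ifPn => //; rewrite notin_setE => /eqP; exact: ai.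
Qed.

Lemma esum_le_fin (I : choiceType) (a : I -> \bar R) r :
  (forall J : {fset I}, \sum_(i <- J) a i <= r) -> \esum_(i in setT) a i <= r.
Proof.
move=> h; apply: ge_ereal_sup => _ [X [fX _] <-].
by rewrite fsbig_finite.
Qed.

Lemma esum_ge_fset (I : choiceType) (a : I -> \bar R) (J : {fset I}) :
  \sum_(i <- J) a i <= \esum_(i in setT) a i.
Proof.
apply: esum_ge; exists [set` J]; first by split => //; exact: finite_fset.
by rewrite fsbig_finite// set_fsetK.
Qed.

(* AM-GM with weights normalizing both sums gives Cauchy-Schwarz. *)
Lemma esum_cauchy_schwarz (I : choiceType) (a b : I -> \bar R) :
  (forall i, 0 <= a i) -> (forall i, 0 <= b i) ->
  (\esum_(i in setT) (a i * b i)) ^+ 2 <=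
  (\esum_(i in setT) a i ^+ 2) * (\esum_(i in setT) b i ^+ 2).
Proof.
move=> a0 b0.
have sq0 (c : I -> \bar R) : (forall i, 0 <= c i) ->
    \esum_(i in setT) c i ^+ 2 = 0 -> forall i, c i = 0.
  move=> c0 h i; have : c i ^+ 2 <= 0.
    by rewrite -h; apply: esum_ge1 => j; rewrite expe2 mule_ge0.
  move=> ci; have : c i ^+ 2 == 0 by rewrite eq_le ci expe2 mule_ge0.
  by rewrite expe_eq0 => /andP[_ /eqP].
have S0 (c : I -> \bar R) : (forall i, 0 <= c i) -> 0 <= \esum_(i in setT) c i ^+ 2.
  by move=> c0; apply: esum_ge0 => i _; rewrite expe2 mule_ge0.
have [A0|An0] := eqVneq (\esum_(i in setT) a i ^+ 2) 0.
  rewrite A0 mul0e esum1 ?expe2 ?mule0// => i _.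
  by rewrite (sq0 _ a0 A0) mul0e.
have [B0|Bn0] := eqVneq (\esum_(i in setT) b i ^+ 2) 0.
  rewrite B0 mule0 esum1 ?expe2 ?mule0// => i _.
  by rewrite (sq0 _ b0 B0) mule0.
have A0 : 0 < \esum_(i in setT) a i ^+ 2 by rewrite lt0e An0 S0.
have B0 : 0 < \esum_(i in setT) b i ^+ 2 by rewrite lt0e Bn0 S0.
have [Ay|] := eqVneq (\esum_(i in setT) a i ^+ 2) +oo.
  by rewrite Ay gt0_mulye// leey.
have [By|] := eqVneq (\esum_(i in setT) b i ^+ 2) +oo.
  by rewrite By gt0_muley// leey.
rewrite -!ltey => By Ay.
have sqfin (c : I -> \bar R) i : (forall i, 0 <= c i) ->
    \esum_(i in setT) c i ^+ 2 < +oo -> c i = (fine (c i))%:E.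
  move=> c0 h; have : c i ^+ 2 < +oo.
    by apply: le_lt_trans h; apply: esum_ge1 => j; rewrite expe2 mule_ge0.
  rewrite expe2; case: (c i) (c0 i) => [//| |//] _.
  by rewrite mulyy ltxx.
have sqrtE (c : \bar R) : 0 < c -> c < +oo ->
    exists A : R, c = (A ^+ 2)%:E /\ (0 < A)%R.
  case: c => [r| |]// r0 _; exists (Num.sqrt r).
  by rewrite lte_fin in r0; rewrite sqrtr_gt0 r0 sqr_sqrtr// ltW.
have [A [AE {}A0]] := sqrtE _ A0 Ay; have [B [BE {}B0]] := sqrtE _ B0 By.
have lAB : \esum_(i in setT) (a i * b i) <= (A * B)%:E.
  have -> : (A * B)%:E = (B / (2 * A))%:E * (\esum_(i in setT) a i ^+ 2) +
      (A / (2 * B))%:E * (\esum_(i in setT) b i ^+ 2).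
    by rewrite AE BE -!EFinM -EFinD; congr EFin; field; rewrite !gt_eqF.
  rewrite -!esumZl ?lee_fin//; last 4 first.
  - by rewrite divr_ge0// ?mulr_ge0// ltW.
  - by move=> i; rewrite expe2 mule_ge0.
  - by rewrite divr_ge0// ?mulr_ge0// ltW.
  - by move=> i; rewrite expe2 mule_ge0.
  rewrite -esumD; last 2 first.
  - by move=> i _; rewrite mule_ge0 ?expe2 ?mule_ge0// lee_fin divr_ge0 ?mulr_ge0// ltW.
  - by move=> i _; rewrite mule_ge0 ?expe2 ?mule_ge0// lee_fin divr_ge0 ?mulr_ge0// ltW.
  apply: le_esum => i _; rewrite (sqfin _ i a0 Ay) (sqfin _ i b0 By).
  rewrite -!EFin_expe -!EFinM -EFinD lee_fin.
  move: (fine (a i)) (fine (b i)) => x y.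
  rewrite -subr_ge0 (_ : (_ - _)%R = ((B * x - A * y) ^+ 2 / (2 * A * B))%R).
    by rewrite divr_ge0 ?sqr_ge0// !mulr_ge0// ltW.
  by field; rewrite !gt_eqF.
rewrite AE BE -EFinM -exprMn EFin_expe !expe2.
by apply: lee_pmul => //; apply: esum_ge0 => i _; rewrite mule_ge0.
Qed.

Lemma sqeD3 (a b c : \bar R) : 0 <= a -> 0 <= b -> 0 <= c ->
  (a + b + c) ^+ 2 <= 3%:E * (a ^+ 2 + b ^+ 2 + c ^+ 2).
Proof.
case: a => [a| |]//; case: b => [b| |]//; case: c => [c| |]// a0 b0 c0;
  rewrite ?expe2/=.
- rewrite -?EFinD -?EFinM -?EFinD -?EFinM lee_fin -subr_ge0.
  rewrite (_ : (_ - _)%R = ((a - b) ^+ 2 + (b - c) ^+ 2 + (a - c) ^+ 2)%R);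
    last by ring.
  by rewrite !addr_ge0// sqr_ge0.
all: rewrite ?addey ?addye// ?mulyy ?addey ?addye// ?gt0_muley ?lte_fin//.
Qed.

Lemma esum_fset_split (I : choiceType) (a : I -> \bar R) (J : {fset I}) :
  (forall i, 0 <= a i) -> \esum_(i in setT) a i =
  \sum_(i <- J) a i + \esum_(i in setT) (if i \in J then 0 else a i).
Proof.
move=> a0; rewrite (esumID [set` J])//; congr (_ + _).
  by rewrite setTI esum_fset// fsbig_finite//= set_fsetK.
rewrite setTI esum_mkcond; apply: eq_esum => i _.
by rewrite in_setC mem_setE; case: (i \in J).
Qed.

(** A finite set whose partial sum is within [e] of the supremum leaves a tail below [e], and
    enlarging the set only shrinks the tail. *)
Lemma esum_tail (I : choiceType) (a : I -> \bar R) (e : R) :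
  (forall i, 0 <= a i) -> \esum_(i in setT) a i < +oo -> (0 < e)%R ->
  exists J0 : {fset I}, forall J : {fset I}, (J0 `<=` J)%fset ->
    \esum_(i in setT) (if i \in J then 0 else a i) < e%:E.
Proof.
move=> a0 ay e0.
set A := \esum_(i in setT) a i in ay *.
have Af : A \is a fin_num by rewrite ge0_fin_numE// esum_ge0.
have [_ [X [fX _] <-] hX] := ub_ereal_sup_adherent e0 Af.
exists (fset_set X) => J J0J.
have AE := esum_fset_split J a0.
have Jf : \sum_(i <- J) a i \is a fin_num.
  rewrite ge0_fin_numE ?sume_ge0//; apply: le_lt_trans ay; exact: esum_ge_fset.
have tf : \esum_(i in setT) (if i \in J then 0 else a i) \is a fin_num.
  rewrite ge0_fin_numE; last by apply: esum_ge0 => i _; case: ifP.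
  by apply: le_lt_trans ay; apply: le_esum => i _; case: ifP.
have : A - e%:E < \sum_(i <- J) a i.
  apply: (lt_le_trans hX); rewrite fsbig_finite//=.
  by apply: lee_sum_nneg_subfset => //; exact/fsubsetP.
rewrite /A AE -(fineK Jf) -(fineK tf) -!EFinD !lte_fin; lra.
Qed.

End Esum.

(** * Haagerup's inequality for the words [y i * y j] *)

Section HaagerupInequality.
Variables (R : realType) (G : groupType).
Local Open Scope ereal_scope.

Lemma esum_le_single (I : choiceType) (P : pred I) (a : I -> \bar R) c :
  0 <= c -> (forall i, 0 <= a i <= c) -> {in P &, forall i j, i = j} ->
  \esum_(i in setT) (if P i then a i else 0) <= c.
Proof.
move=> c0 a0 Pi; have [[i Pii]|nP] := pselect (exists i, P i).
  rewrite (@esum_single _ _ _ i) ?Pii//; first by have /andP[] := a0 i.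
    by have /andP[] := a0 i.
  by move=> j; case: ifPn => // Pj /eqP[]; exact: Pi.
rewrite esum1// => i _; case: ifPn => // Pi'; case: nP; by exists i.
Qed.

(* k selects pairs (s, r) such that the class alpha s is determined by the
   product s r, and s is determined by r and alpha s. *)
Lemma partial_convolution_bound (A : eqType) (k : G -> G -> bool)
    (alpha : G -> A) (f x : G -> \bar R) :
  (forall s, 0 <= f s) -> (forall s, 0 <= x s) ->
  (forall s s' r r', k s r -> k s' r' -> (s * r = s' * r')%g ->
    alpha s = alpha s') ->
  (forall s s' r, k s r -> k s' r -> alpha s = alpha s' -> s = s') ->
  \esum_(t in setT) (\esum_(s in setT)
    (if k s (s^-1 * t)%g then f s * x (s^-1 * t)%g else 0)) ^+ 2 <=
  (\esum_(s in setT) f s ^+ 2) * (\esum_(s in setT) x s ^+ 2).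
Proof.
move=> f0 x0 ka kb.
have sq0 (y : \bar R) : 0 <= y ^+ 2 by rewrite expe2 sqre_ge0.
(* [s'] carries the weight of [f] and [r] that of [x]; for fixed [s'] and [r] at most one [s] will
   contribute. *)
pose b s' s r := if (alpha s' == alpha s) && k s r then f s' ^+ 2 * x r ^+ 2 else 0.
have b0 s' s r : 0 <= b s' s r by rewrite /b; case: ifP => // _; rewrite mule_ge0.
have -> : (\esum_(s in setT) f s ^+ 2) * (\esum_(s in setT) x s ^+ 2) =
    \esum_(s in setT) \esum_(r in setT) (f s ^+ 2 * x r ^+ 2).
  rewrite -esumZr//; last by apply: esum_ge0 => *.
  by apply: eq_esum => s _; rewrite esumZl.
apply: (@le_trans _ _ (\esum_(t in setT) \esum_(s' in setT) \esum_(s in setT)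
    b s' s (s^-1 * t)%g)).
  apply: le_esum => t _.
  (* Cauchy-Schwarz at fixed [t]. The selected [s] and [s'] both belong to factorizations of [t], so
     by [ka] they share a class, and every product of squares is counted by [b]. *)
  rewrite (@eq_esum _ _ _ _ (fun s => (if k s (s^-1 * t)%g then f s else 0) *
    (if k s (s^-1 * t)%g then x (s^-1 * t)%g else 0))); last first.
    by move=> s _; case: ifP => //; rewrite mul0e.
  apply: le_trans (esum_cauchy_schwarz _ _) _.
  - by move=> s; case: ifP.
  - by move=> s; case: ifP.
  rewrite -esumZr//; last by apply: esum_ge0 => *.
  apply: le_esum => s' _; rewrite -esumZl//; apply: le_esum => s _; rewrite /b.
  case: ifPn => k's; last by rewrite expe2 mul0e mul0e;
    case: ifP => // _; rewrite mule_ge0.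
  case: ifPn => ks; last by rewrite andbF [X in _ * X]expe2 mule0 mule0.
  by rewrite (ka _ _ _ _ k's ks) ?eqxx// !mulVKg.
rewrite exchange_esum; last by move=> t s'; apply: esum_ge0.
apply: le_esum => s' _; rewrite exchange_esum//.
(* For fixed [s] the variable [t] becomes [r = s^-1 t]; then [kb] leaves at most one [s] in the
   class of [s']. *)
under eq_esum => s _.
  rewrite -(@esum_bij _ _ _ (b s' s) (fun t => s^-1 * t)%g); first over.
  by exists (fun t => s * t)%g => t; [exact: mulVKg|exact: mulKg].
rewrite exchange_esum//; apply: le_esum => r _; rewrite /b.
apply: (esum_le_single (a := fun=> f s' ^+ 2 * x r ^+ 2)); rewrite ?mule_ge0//.
  by move=> s; rewrite lexx.
move=> s1 s2 /andP[/eqP a1 k1] /andP[/eqP a2 k2]; apply: kb k1 k2 _.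
by rewrite -a1.
Qed.


Variables (y : nat -> G) (tau : G -> nat * bool).
Hypothesis pingpong :
  forall i g, tau g <> (i, false) -> tau (y i * g)%g = (i, true).

Definition pair_words : set G := [set s | exists i j, s = (y i * y j)%g].

(** Multiplied by a [g] whose tag has sign [true], the word suffers no cancellation: [tau] reads off
    [i], then, once the common first letter is removed, [j]. *)
Lemma pair_word_inj i j i' j' :
  (y i * y j = y i' * y j')%g -> i = i' /\ j = j'.
Proof.
(* If the tag of [1] is [(n, false)], the letter [y n.+1] does not cancel against it. *)
have [g tg] : exists g, (tau g).2 = true.
  case E : (tau 1%g) => [n []]; first by exists 1%g; rewrite E.
  exists (y n.+1 * 1)%g; rewrite pingpong// E => -[] /eqP.
  by rewrite -[X in X == _]addn0 -addn1 eqn_add2l.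
have tj k : tau (y k * g)%g = (k, true).
  by apply: pingpong => e; rewrite e in tg.
have ti k l : tau (y k * (y l * g))%g = (k, true).
  by apply: pingpong; rewrite tj.
move=> e; have := ti i j; rewrite mulgA e -mulgA ti => -[ii]; split=> //.
by move: e (tj j); rewrite ii => /mulgI ->; rewrite tj => -[].
Qed.

(* A product y_i y_j r cancels nothing, only y_j, or both letters; these three
   cases give the first column, the matrix and the last row of f. *)
Lemma haagerup_inequality (f x : G -> \bar R) :
  (forall s, 0 <= f s) -> (forall s, 0 <= x s) ->
  (forall s, ~ pair_words s -> f s = 0) ->
  \esum_(t in setT) (\esum_(s in setT) f s * x (s^-1 * t)%g) ^+ 2 <=
  9%:E * ((\esum_(s in setT) f s ^+ 2) * (\esum_(s in setT) x s ^+ 2)).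
Proof.
move=> f0 x0 fE; pose E s := `[< pair_words s >].
have /choice[w wE] s : exists e, E s -> s = (y e.1 * y e.2)%g.
  have [/asboolP[i [j sE]]|nE] := boolP (E s); first by exists (i, j).
  by exists (0%N, 0%N).
(* The tag [(j, false)] on [r] stands for a leading inverse of [y j], which cancels the second
   letter of [s]; the tag of [y j * r] decides likewise about the first letter. *)
pose k1 s r := E s && (tau r != ((w s).2, false)).
pose k2 s r := [&& E s, tau r == ((w s).2, false) &
  tau (y (w s).2 * r)%g != ((w s).1, false)].
pose k3 s r := [&& E s, tau r == ((w s).2, false) &
  tau (y (w s).2 * r)%g == ((w s).1, false)].
pose c (k : G -> G -> bool) t := \esum_(s in setT)
  (if k s (s^-1 * t)%g then f s * x (s^-1 * t)%g else 0).
have c0 k t : 0 <= c k t.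
  by apply: esum_ge0 => s _; case: ifP => // _; rewrite mule_ge0.
have top s r (i := (w s).1) (j := (w s).2) :
    E s -> tau (y j * r)%g != (i, false) -> tau (s * r)%g = (i, true).
  by move=> Es h; rewrite {1}(wE _ Es) -mulgA pingpong//; apply/eqP.
have tfF (i j : nat) : (i, true) != (j, false) by rewrite xpair_eqE andbF.
have b1 : \esum_(t in setT) c k1 t ^+ 2 <=
    (\esum_(s in setT) f s ^+ 2) * (\esum_(s in setT) x s ^+ 2).
  (* Nothing cancels, so [tau] reads both letters off the product and the class is the pair of
     letters. *)
  apply: (@partial_convolution_bound _ k1 w) => //.
    move=> s s' r r' /andP[Es /eqP sr] /andP[Es' /eqP sr'] e.
    have := top s r Es; rewrite pingpong// => /(_ (tfF _ _)).
    have := top s' r' Es'; rewrite pingpong// => /(_ (tfF _ _)).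
    rewrite e => -> -[ii].
    have {}e : (y (w s).2 * r = y (w s').2 * r')%g.
      by apply: (mulgI (y (w s).1)); rewrite -{2}ii !mulgA -(wE _ Es) -(wE _ Es').
    have := pingpong sr; rewrite e pingpong// => -[jj].
    by move: ii jj; case: (w s) (w s') => ? ? [? ?] /= -> ->.
  by move=> s s' r /andP[Es _] /andP[Es' _]; rewrite {2}(wE _ Es) {2}(wE _ Es') => ->.
have b2 : \esum_(t in setT) c k2 t ^+ 2 <=
    (\esum_(s in setT) f s ^+ 2) * (\esum_(s in setT) x s ^+ 2).
  (* The product shows the first letter, the tag of [r] the second. *)
  apply: (@partial_convolution_bound _ k2 (fun s => (w s).1)) => //.
    move=> s s' r r' /and3P[Es _ sr] /and3P[Es' _ sr'] e.
    by have := top _ _ Es sr; rewrite e (top _ _ Es' sr') => -[].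
  move=> s s' r /and3P[Es /eqP sr _] /and3P[Es' /eqP + _]; rewrite sr => -[jj] ii.
  by rewrite (wE _ Es) (wE _ Es') ii jj.
have b3 : \esum_(t in setT) c k3 t ^+ 2 <=
    (\esum_(s in setT) f s ^+ 2) * (\esum_(s in setT) x s ^+ 2).
  (* Here [r] alone determines both letters, so a single class suffices. *)
  apply: (@partial_convolution_bound _ k3 (fun=> tt)) => //.
  move=> s s' r /and3P[Es /eqP sr /eqP sr2] /and3P[Es' /eqP + /eqP +] _.
  rewrite sr => -[jj]; rewrite -jj sr2 => -[ii].
  by rewrite (wE _ Es) (wE _ Es') ii jj.
set B := _ * _ in b1 b2 b3 *.
(* In 9 one factor 3 comes from squaring a sum of three terms, the other from adding [b1], [b2] and
   [b3]. *)
apply: (@le_trans _ _ (\esum_(t in setT)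
    (3%:E * (c k1 t ^+ 2 + c k2 t ^+ 2 + c k3 t ^+ 2)))).
  apply: le_esum => t _; apply: le_trans (sqeD3 _ _ _) => //.
  rewrite le_eqVlt; apply/orP; left; apply/eqP; congr (_ ^+ 2).
  have t0 (k : G -> G -> bool) s :
      0 <= (if k s (s^-1 * t)%g then f s * x (s^-1 * t)%g else 0).
    by case: ifP => // _; rewrite mule_ge0.
  rewrite /c -!esumD//; last by move=> s _; rewrite adde_ge0.
  apply: eq_esum => s _; rewrite /k1 /k2 /k3.
  have [Es|/asboolPn/fE ->] := boolP (E s); last by rewrite mul0e !adde0.
  by case: (tau (s^-1 * t)%g == _) => /=; [case: (tau _ == _) => /=|];
    rewrite ?adde0 ?add0e.
have sq0 (z : \bar R) : 0 <= z ^+ 2 by rewrite expe2 sqre_ge0.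
rewrite esumZl//; last by move=> t; rewrite !adde_ge0.
rewrite !esumD//; last by move=> t _; rewrite !adde_ge0.
have -> : 9%:E * B = 3%:E * (3%:E * B).
  by rewrite [RHS]muleA -EFinM; congr (_%:E * _); ring.
rewrite lee_pmul2l//; apply: (@le_trans _ _ (B + B + B)); first by rewrite !leeD.
have B0 : 0 <= B by rewrite mule_ge0// esum_ge0.
have -> : 3%R = (1 + 1 + 1)%R :> R by ring.
by rewrite !EFinD !ge0_muleDl ?mul1e ?lee_fin ?addr_ge0.
Qed.

End HaagerupInequality.

(* Unconditional sums of complex families *)
#[local] Existing Instance summability.totally_filter.

Section UnconditionalSums.
Variables (R : realType) (I : choiceType).
Local Notation C := R[i].
Local Notation normc := Normc.normc.
Implicit Types z w : I -> C.

Lemma rnorm_normc (c : C) : rnorm (c : C^o) = normc c.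
Proof. by []. Qed.

Lemma normcR (x : R) : normc x%:C = `|x|.
Proof. by rewrite /= expr0n/= addr0 sqrtr_sqr. Qed.

Lemma partial_sumE (V : zmodType) (x : I -> V) (J : {fset I}) :
  summability.partial_sum x J = \sum_(i <- J) x i.
Proof. by rewrite /summability.partial_sum big_seq_fsetE. Qed.

Lemma cvg_totallyP (W : normedModType C) (f : {fset I} -> W) (l : W) :
  f @ summability.totally --> l <->
  forall e : R, 0 < e -> exists J0 : {fset I},
    forall J, (J0 `<=` J)%fset -> rnorm (l - f J) < e.
Proof.
split.
  move=> /cvgrPdist_lt fl e e0.
  have [J0 _ hJ] := fl e%:C (ltac:(by rewrite ltcR)).
  by exists J0 => J /hJ /=; rewrite normE ltcR.
move=> h; apply/cvgrPdist_lt => e e0.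
(* In the order on the complex numbers every positive element is real. *)
have eE : e = (complex.Re e)%:C.
  by case: e e0 => a b; rewrite ltcE /= => /andP[/eqP -> _].
have e0' : 0 < complex.Re e by rewrite -ltcR -eE.
have [J0 hJ] := h _ e0'; exists J0 => // J /= J0J.
by rewrite normE eE ltcR; exact: hJ.
Qed.

Definition csum z : C := summability.sum (z : I -> C^o).

Definition abs_summable z := (\esum_(i in setT) (normc (z i))%:E < +oo)%E.

Lemma csum_unique z (l : C) :
  (summability.partial_sum z : {fset I} -> C^o) @ summability.totally --> (l : C^o) ->
  csum z = l.
Proof. by move=> zl; apply: cvg_lim zl; exact: norm_hausdorff. Qed.

Lemma cvg_csum_nonneg (a : I -> R) : (forall i, 0 <= a i) ->
  (\esum_(i in setT) (a i)%:E < +oo)%E ->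
  (summability.partial_sum (fun i => (a i)%:C) : {fset I} -> C^o) @ summability.totally -->
    ((fine (\esum_(i in setT) (a i)%:E))%:C : C^o).
Proof.
move=> a0 ay; apply/cvg_totallyP => e e0.
have a0' i : (0 <= (a i)%:E)%E by rewrite lee_fin.
have [J0 hJ] := esum_tail a0' ay e0; exists J0 => J /hJ.
rewrite partial_sumE -rmorph_sum -rmorphB rnorm_normc normcR.
rewrite (esum_fset_split J a0') sumEFin.
set t := (\esum_(i in _) _)%E; have : (0 <= t)%E by apply: esum_ge0 => i _; case: ifP.
case: t => [t| |]//; rewrite !lte_fin lee_fin/= => t0 te.
by rewrite addrAC subrr add0r ger0_norm.
Qed.

Lemma cvg_csum z : abs_summable z ->
  (summability.partial_sum z : {fset I} -> C^o) @ summability.totally --> (csum z : C^o).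
Proof.
move=> zy; suff [l zl] : exists l : C^o,
  (summability.partial_sum z : {fset I} -> C^o) @ summability.totally --> l.
  by rewrite (csum_unique zl).
have le_n (c : C) : `|complex.Re c| <= normc c /\ `|complex.Im c| <= normc c.
  case: c => x y /=; split; rewrite -sqrtr_sqr ler_wsqrtr//.
    by rewrite lerDl sqr_ge0.
  by rewrite lerDr sqr_ge0.
(* For [f] the real or imaginary part, [f z] is the difference of [|z| + f z] and [|z|], which are
   nonnegative and summable. *)
have parts (f : C -> R) : (forall c, `|f c| <= normc c) -> exists l : C^o,
    (summability.partial_sum (fun i => (f (z i))%:C) : {fset I} -> C^o)
      @ summability.totally --> l.
  move=> fn.
  have f1 := cvg_csum_nonneg (fun i => Defs.normc_ge0 (z i)) zy.
  have f0 i : 0 <= normc (z i) + f (z i).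
    by have := fn (z i); rewrite ler_norml => /andP[+ _]; lra.
  have fy : (\esum_(i in setT) (normc (z i) + f (z i))%:E < +oo)%E.
    apply: (@le_lt_trans _ _ (2%:E * (\esum_(i in setT) (normc (z i))%:E))%E).
      rewrite -esumZl//; last by move=> i; rewrite lee_fin Defs.normc_ge0.
      apply: le_esum => i _; rewrite -EFinM lee_fin mulr_natl mulr2n lerD2l.
      exact: le_trans (ler_norm _) (fn _).
    by rewrite lte_mul_pinfty.
  have f2 := cvg_csum_nonneg f0 fy.
  eexists; rewrite (_ : summability.partial_sum _ = fun J =>
    (summability.partial_sum (fun i => (normc (z i) + f (z i))%:C) J : C^o)
    - summability.partial_sum (fun i => (normc (z i))%:C) J).
    exact: cvgB f2 f1.
  apply/funext => J; rewrite !partial_sumE -sumrB; apply: eq_bigr => i _.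
  by rewrite -rmorphB/= addrAC subrr add0r.
have [l1 h1] := parts _ (fun c => proj1 (le_n c)).
have [l2 h2] := parts _ (fun c => proj2 (le_n c)).
exists (l1 + ('i : C) *: l2); rewrite (_ : summability.partial_sum _ = fun J =>
    (summability.partial_sum (fun i => (complex.Re (z i))%:C) J : C^o) +
    ('i : C) *: (summability.partial_sum (fun i => (complex.Im (z i))%:C) J : C^o)).
  have h3 := cvgZl_tmp (k := ('i : C)) h2.
  exact: cvgD h1 (h3 _).
apply/funext => J; rewrite !partial_sumE scaler_sumr -big_split/=.
by apply: eq_bigr => i _; rewrite [LHS]complexE.
Qed.

Lemma csumE z (J : {fset I}) : (forall i, i \notin J -> z i = 0) ->
  csum z = \sum_(i <- J) z i.
Proof.
move=> zJ; apply: csum_unique; apply/cvg_totallyP => e e0; exists J => K JK.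
rewrite partial_sumE (big_fset_incl _ JK)/= ?subrr ?rnorm0// => i _; exact: zJ.
Qed.

Lemma csum_single z i : (forall j, j != i -> z j = 0) -> csum z = z i.
Proof.
move=> zi; rewrite (@csumE _ [fset i]%fset) ?big_seq_fset1// => j.
by rewrite inE; exact: zi.
Qed.

Lemma eq_csum z w : z =1 w -> csum z = csum w.
Proof. by move=> /funext ->. Qed.

Lemma abs_summableD z w : abs_summable z -> abs_summable w ->
  abs_summable (fun i => z i + w i).
Proof.
move=> zy wy; apply: (@le_lt_trans _ _ (\esum_(i in setT)
    ((normc (z i))%:E + (normc (w i))%:E))%E).
  by apply: le_esum => i _; rewrite -EFinD lee_fin Defs.normcD.
by rewrite esumD ?lte_add_pinfty// => i _; rewrite lee_fin Defs.normc_ge0.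
Qed.

Lemma abs_summableZ (a : C) z : abs_summable z -> abs_summable (fun i => a * z i).
Proof.
move=> zy; rewrite /abs_summable; under eq_esum do rewrite Normc.normcM EFinM.
rewrite esumZl ?lee_fin ?Defs.normc_ge0//.
  by rewrite lte_mul_pinfty// lee_fin Defs.normc_ge0.
by move=> i; rewrite lee_fin Defs.normc_ge0.
Qed.

Lemma csum_linear (a : C) z w : abs_summable z -> abs_summable w ->
  csum (fun i => a * z i + w i) = a * csum z + csum w.
Proof.
move=> zy wy; apply: csum_unique; rewrite (_ : summability.partial_sum _ = fun J =>
    a *: (summability.partial_sum z J : C^o) + (summability.partial_sum w J : C^o)).
  have h := cvgZl_tmp (k := a) (cvg_csum zy).
  exact: cvgD (h _) (cvg_csum wy).
apply/funext => J; rewrite !partial_sumE scaler_sumr -big_split/=.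
by apply: eq_bigr => i _.
Qed.

Lemma normc_sum (J : {fset I}) z :
  normc (\sum_(i <- J) z i) <= \sum_(i <- J) normc (z i).
Proof.
elim/big_rec2 : _ => [|i x c _ h]; first by rewrite Normc.normc0.
by apply: le_trans (Defs.normcD _ _) _; rewrite lerD2l.
Qed.

Lemma normc_csum_le z :
  ((normc (csum z))%:E <= \esum_(i in setT) (normc (z i))%:E)%E.
Proof.
have n0 i : (0 <= (normc (z i))%:E)%E by rewrite lee_fin Defs.normc_ge0.
have [zy|] := ltP (\esum_(i in setT) (normc (z i))%:E)%E +oo%E; last first.
  by rewrite leye_eq => /eqP ->; rewrite leey.
apply/lee_addgt0Pr => e e0.
have /cvg_totallyP/(_ e e0)[J hJ] := cvg_csum zy.
have := hJ J (fsubset_refl _); rewrite partial_sumE rnorm_normc => h.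
apply: (@le_trans _ _ (\sum_(i <- J) (normc (z i))%:E + e%:E)%E); last first.
  by rewrite leeD2r// esum_ge_fset.
rewrite sumEFin -EFinD lee_fin.
apply: (@le_trans _ _ (normc (\sum_(i <- J) z i + (csum z - \sum_(i <- J) z i)))).
  by rewrite addrC subrK.
by apply: le_trans (Defs.normcD _ _) _; rewrite lerD ?normc_sum// ltW.
Qed.

End UnconditionalSums.

(** * Convolution operators on ell^2 *)

Section Convolution.
Variables (R : realType) (G : groupType).
Local Notation C := R[i].
Local Notation H := (ell2 R G).
Local Notation B := (bop H).
Local Notation normc := Normc.normc.
Implicit Types (f g x : G -> C) (t s : G).

Lemma ell2P (x y : H) : (x : G -> C) =1 y -> x = y.
Proof. by move=> /funext e; apply/val_inj. Qed.

Lemma bopP (S T : B) : (forall (x : H) t, S x t = T x t) -> S = T.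
Proof. by move=> e; apply/val_inj/funext => x; apply: ell2P => t; exact: e. Qed.

Lemma ell2_addE (x y : H) t : (x + y) t = x t + y t.
Proof. by []. Qed.

Lemma ell2_scaleE (a : C) (x : H) t : (a *: x) t = a * x t.
Proof. by []. Qed.

Lemma bop_addE (S T : B) (x : H) : (S + T) x = S x + T x.
Proof. by []. Qed.

Lemma bop_scaleE (a : C) (T : B) (x : H) : (a *: T) x = a *: T x.
Proof. by []. Qed.

Lemma fct_linearE (a : C) f g t : (a *: f + g) t = a * f t + g t.
Proof. by []. Qed.

Lemma ell2_linearE (a : C) (x y : H) :
  a *: x + y = a *: (x : G -> C) + y :> (G -> C).
Proof. by apply/funext => t; rewrite ell2_addE ell2_scaleE fct_linearE. Qed.

Lemma rnorm_l2norm (x : H) : rnorm x = l2norm x.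
Proof. by []. Qed.

Lemma sqsumE f : sqsum f = (\esum_(s in setT) (normc (f s))%:E ^+ 2)%E.
Proof. by apply: eq_esum => s _; rewrite EFin_expe. Qed.

Lemma le_sqsum f g : (forall s, normc (f s) <= normc (g s)) ->
  (sqsum f <= sqsum g)%E.
Proof.
move=> fg; apply: le_esum => s _; rewrite lee_fin.
by rewrite ler_pXn2r// nnegrE Defs.normc_ge0.
Qed.

Definition absconv f x t : \bar R :=
  (\esum_(s in setT) (normc (f s))%:E * (normc (x (s^-1 * t)%g))%:E)%E.

Definition conv f x t : C := csum (fun s => f s * x (s^-1 * t)%g).

(** The bound concerns absolute values, so it passes to every function dominated by [f], in
    particular to truncations; this is also the form Haagerup's inequality takes. *)
Definition conv_bounded f (M : R) := 0 <= M /\ forall x,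
  (\esum_(t in setT) absconv f x t ^+ 2 <= (M ^+ 2)%:E * sqsum x)%E.

Lemma sqsum_reflect x t : sqsum (fun s => x (s^-1 * t)%g) = sqsum x.
Proof.
rewrite [RHS](@esum_bij _ _ _ _ (fun s => s^-1 * t)%g)//.
exists (fun s => t * s^-1)%g => s; first by rewrite invgM invgK mulVKg.
by rewrite invgM invgK mulgVK.
Qed.

Lemma absconv_ge0 f x t : (0 <= absconv f x t)%E.
Proof. by apply: esum_ge0 => s _; rewrite mule_ge0 ?lee_fin ?Defs.normc_ge0. Qed.

Lemma absconv_fin f x t : (sqsum f < +oo)%E -> (sqsum x < +oo)%E ->
  (absconv f x t < +oo)%E.
Proof.
move=> fy xy.
have n0 (y : G -> C) s : (0 <= (normc (y s))%:E)%E by rewrite lee_fin Defs.normc_ge0.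
have := esum_cauchy_schwarz (n0 f) (n0 (fun s => x (s^-1 * t)%g)).
rewrite -!sqsumE sqsum_reflect -/(absconv f x t) => h.
have : (absconv f x t ^+ 2 < +oo)%E.
  by apply: le_lt_trans h _; rewrite (sqsum_fin fy) (sqsum_fin xy) -EFinM ltry.
by case: (absconv f x t) => [r _| |]; rewrite ?ltry ?ltNyr// expe2 mulyy ltxx.
Qed.

Lemma conv_summable f x t : (sqsum f < +oo)%E -> (sqsum x < +oo)%E ->
  abs_summable (fun s => f s * x (s^-1 * t)%g).
Proof.
move=> fy xy; rewrite /abs_summable.
under eq_esum do rewrite Normc.normcM EFinM.
exact: absconv_fin.
Qed.

Lemma normc_conv_le f x t : ((normc (conv f x t))%:E <= absconv f x t)%E.
Proof.
apply: le_trans (normc_csum_le _) _.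
by apply: le_esum => s _; rewrite Normc.normcM EFinM.
Qed.

Lemma conv_linearr f (a : C) (x y : G -> C) t :
  (sqsum f < +oo)%E -> (sqsum x < +oo)%E -> (sqsum y < +oo)%E ->
  conv f (a *: x + y) t = a * conv f x t + conv f y t.
Proof.
move=> fy xy yy; rewrite /conv -csum_linear; last 2 first.
- exact: conv_summable.
- exact: conv_summable.
by apply: eq_csum => s; rewrite !fctE mulrDr mulrCA.
Qed.

Lemma conv_linearl (a : C) f g x t :
  (sqsum f < +oo)%E -> (sqsum g < +oo)%E -> (sqsum x < +oo)%E ->
  conv (a *: f + g) x t = a * conv f x t + conv g x t.
Proof.
move=> fy gy xy; rewrite /conv -csum_linear; last 2 first.
- exact: conv_summable.
- exact: conv_summable.
by apply: eq_csum => s; rewrite !fctE mulrDl -mulrA.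
Qed.

Lemma sqsum_conv f M x : conv_bounded f M ->
  (sqsum (conv f x) <= (M ^+ 2)%:E * sqsum x)%E.
Proof.
move=> [_ fM]; apply: le_trans (fM x); rewrite sqsumE; apply: le_esum => t _.
rewrite !expe2; apply: lee_pmul => //; rewrite ?lee_fin ?Defs.normc_ge0//;
  exact: normc_conv_le.
Qed.

Definition delta s : G -> C := fun t => if t == s then 1 else 0.

Lemma sqsum_delta s : sqsum (delta s) = 1%E.
Proof.
rewrite /sqsum (@esum_single _ _ _ s).
- by rewrite /delta eqxx Normc.normc1 expr1n.
- by rewrite lee_fin sqr_ge0.
- by move=> t /negPf ts; rewrite /delta ts Normc.normc0 expr0n.
Qed.

Fact delta_l2 s : delta s \in l2pred (G := G).
Proof. by apply/asboolP; rewrite sqsum_delta ltry. Qed.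

Definition ell2_delta s : H := Ell2 (delta_l2 s).

Lemma rnorm_delta s : rnorm (ell2_delta s) = 1.
Proof. by rewrite rnorm_l2norm /l2norm sqsum_delta/= sqrtr1. Qed.

Lemma conv_delta1 f t : conv f (delta 1%g) t = f t.
Proof.
rewrite /conv (@csum_single _ _ _ t); first by rewrite mulVg /delta eqxx mulr1.
move=> s st; rewrite /delta; case: eqP => [e|]; last by rewrite mulr0.
by move: st; rewrite -[t](mulVKg s) e mulg1 eqxx.
Qed.

(** Convolving [f] with the unit vector [delta 1] returns [f]. *)
Lemma conv_bounded_sqsum f M : conv_bounded f M -> (sqsum f <= (M ^+ 2)%:E)%E.
Proof.
move=> /(sqsum_conv (delta 1%g)); rewrite sqsum_delta mule1.
by rewrite (_ : conv f _ = f)//; apply/funext => t; exact: conv_delta1.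
Qed.

Lemma conv_bounded_fin f M : conv_bounded f M -> (sqsum f < +oo)%E.
Proof. by move=> /conv_bounded_sqsum/le_lt_trans; apply; rewrite ltry. Qed.

(** Takes the value 0 when convolution by [f] is not a bounded operator. *)
Definition conv_op f : B :=
  xget 0 [set T : B | forall (x : H) t, T x t = conv f x t].

Lemma conv_op_unique f (T : B) :
  (forall (x : H) t, T x t = conv f x t) -> conv_op f = T.
Proof.
move=> Tf; apply: bopP => x t; rewrite Tf /conv_op.
by case: xgetP => [S -> ->//|/(_ T)[]].
Qed.

Lemma conv_op_exists f M : conv_bounded f M ->
  exists2 T : B, (forall (x : H) t, T x t = conv f x t) & rnorm T <= M.
Proof.
move=> fM; have fy := conv_bounded_fin fM.
have cl2 (x : H) : conv f x \in l2pred (G := G).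
  apply/asboolP; apply: le_lt_trans (sqsum_conv _ fM) _.
  by rewrite (sqsum_fin (ell2_fin x)) -EFinM ltry.
pose T (x : H) : H := Ell2 (cl2 x).
have nT (x : H) : rnorm (T x) <= M * rnorm x.
  have [M0 _] := fM.
  apply: sqsum_le; first by rewrite mulr_ge0// rnorm_ge0.
  rewrite exprMn EFinM -sqsum_fin ?ell2_fin//; exact: sqsum_conv.
have Tb : T \in boppred (V := H).
  apply/asboolP; split; last by exists M.
  move=> a x y; apply: ell2P => t; rewrite ell2_addE ell2_scaleE.
  transitivity (conv f (a *: (x : G -> C) + (y : G -> C)) t); first by rewrite -ell2_linearE.
  by apply: conv_linearr => //; exact: ell2_fin.
exists (Bop Tb) => //; apply: opnorm_le => x x1.
by apply: le_trans (nT x) _; rewrite ler_piMr//; case: fM.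
Qed.

Lemma conv_opE f M : conv_bounded f M ->
  forall (x : H) t, conv_op f x t = conv f x t.
Proof.
by move=> /conv_op_exists[T TE _] x t; rewrite (conv_op_unique TE) TE.
Qed.

Lemma rnorm_conv_op f M : conv_bounded f M -> rnorm (conv_op f) <= M.
Proof. by move=> /conv_op_exists[T TE TM]; rewrite (conv_op_unique TE). Qed.

Lemma conv_op_linear (a : C) f g M N : conv_bounded f M -> conv_bounded g N ->
  conv_op (a *: f + g) = a *: conv_op f + conv_op g.
Proof.
move=> fM gN; apply: conv_op_unique => x t.
rewrite bop_addE bop_scaleE ell2_addE ell2_scaleE.
rewrite (conv_opE fM) (conv_opE gN).
symmetry; apply: conv_linearl.
- exact: conv_bounded_fin fM.
- exact: conv_bounded_fin gN.
- exact: ell2_fin.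
Qed.

Lemma bop_sumE (I : Type) (r : seq I) (T : I -> B) (x : H) t :
  (\sum_(i <- r) T i) x t = \sum_(i <- r) T i x t.
Proof. by elim/big_rec2 : _ => // i y S _ <-. Qed.

Definition cut (J : {fset G}) f : G -> C := fun s => if s \in J then 0 else f s.

Lemma conv_op_finsupp f (J : {fset G}) : (forall s, s \notin J -> f s = 0) ->
  conv_op f = \sum_(s <- J) f s *: lreg R s.
Proof.
move=> fJ; apply: conv_op_unique => x t; rewrite bop_sumE /conv (@csumE _ _ _ J)//.
by move=> s /fJ ->; rewrite mul0r.
Qed.

Lemma conv_bounded_le f g M : (forall s, normc (f s) <= normc (g s)) ->
  conv_bounded g M -> conv_bounded f M.
Proof.
move=> fg [M0 gM]; split=> // x; apply: le_trans (gM x); apply: le_esum => t _.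
rewrite !expe2; apply: lee_pmul; rewrite ?absconv_ge0//;
by apply: le_esum => s _; rewrite -!EFinM lee_fin ler_wpM2r ?Defs.normc_ge0.
Qed.

(** Turns the error of a finite partial sum into a convolution operator, so that norm bounds for the
    tail of [f] apply to it. *)
Lemma conv_op_cut f M (J : {fset G}) : conv_bounded f M ->
  conv_op (cut J f) = conv_op f - \sum_(s <- J) f s *: lreg R s.
Proof.
move=> fM; have fy := conv_bounded_fin fM.
pose g s := if s \in J then f s else 0.
have gf s : normc (g s) <= normc (f s).
  by rewrite /g; case: ifP => // _; rewrite Normc.normc0 Defs.normc_ge0.
have gJ s : s \notin J -> g s = 0 by rewrite /g => /negPf ->.
have -> : \sum_(s <- J) f s *: lreg R s = conv_op g.
  rewrite (conv_op_finsupp gJ) big_seq [RHS]big_seq; apply: eq_bigr => s sJ.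
  by rewrite /g sJ.
have -> : cut J f = (-1) *: g + f.
  apply/funext => s; rewrite !fctE /cut /g; case: ifP => _.
    by rewrite scaleN1r addNr.
  by rewrite scaler0 add0r.
by rewrite (conv_op_linear _ (conv_bounded_le gf fM) fM) scaleN1r addrC.
Qed.

(** Young's inequality: write [|f|] as a product of two square roots, apply Cauchy-Schwarz at each
    [t], and exchange the sums over [t] and [s]. *)
Lemma conv_bounded_ell1 f : ell1 f ->
  conv_bounded f (fine (\esum_(s in setT) (normc (f s))%:E)%E).
Proof.
move=> fy; set A := (\esum_(s in setT) _)%E.
have f0 s : (0 <= (normc (f s))%:E)%E by rewrite lee_fin Defs.normc_ge0.
have A0 : (0 <= A)%E by apply: esum_ge0.
have Af : A \is a fin_num by rewrite ge0_fin_numE.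
split; first by rewrite fine_ge0.
move=> x; rewrite EFin_expe fineK//.
pose a s := (Num.sqrt (normc (f s)))%:E.
have a0 s : (0 <= a s)%E by rewrite lee_fin sqrtr_ge0.
have n0 s : (0 <= (normc (x s))%:E)%E by rewrite lee_fin Defs.normc_ge0.
have aa s : (a s * a s = (normc (f s))%:E)%E.
  by rewrite -EFinM -expr2 sqr_sqrtr ?Defs.normc_ge0.
have sq0 (z : \bar R) : (0 <= z ^+ 2)%E by rewrite expe2 sqre_ge0.
apply: (@le_trans _ _ (\esum_(t in setT) (A *
    \esum_(s in setT) ((normc (f s))%:E * (normc (x (s^-1 * t)%g))%:E ^+ 2)))%E).
  apply: le_esum => t _.
  have := @esum_cauchy_schwarz _ _ a (fun s => a s * (normc (x (s^-1 * t)%g))%:E)%E a0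
    (fun s => mule_ge0 (a0 _) (n0 _)).
  congr (_ <= _)%E.
    congr (_ ^+ 2)%E; apply: eq_esum => s _; by rewrite muleA aa.
  congr (_ * _)%E; apply: eq_esum => s _; first by rewrite expe2 aa.
  by rewrite !expe2 muleACA aa.
rewrite esumZl//; last by move=> t; apply: esum_ge0 => s _; rewrite mule_ge0.
rewrite expe2 -muleA; apply: lee_pmul => //.
  by apply: esum_ge0 => t _; apply: esum_ge0 => s _; rewrite mule_ge0.
rewrite exchange_esum; last by move=> t s; rewrite mule_ge0.
rewrite -esumZr ?sqsum_ge0//; apply: le_esum => s _.
rewrite esumZl//; apply: lee_pmul => //; first by apply: esum_ge0.
rewrite sqsumE (@esum_bij _ _ _ (fun t => (normc (x t))%:E ^+ 2)%E (fun t => s^-1 * t)%g)//.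
by exists (fun t => s * t)%g => t; [exact: mulVKg|exact: mulKg].
Qed.

(** The series defining [lambda0 f] converges in operator norm, because the norm of the remainder is
    at most the ell^1 norm of the tail. *)
Lemma lambda0E f : ell1 f -> lambda0 f = conv_op f.
Proof.
move=> fy; have fb := conv_bounded_ell1 fy.
apply: cvg_lim; first exact: norm_hausdorff.
apply/cvg_totallyP => e e0.
have f0 s : (0 <= (normc (f s))%:E)%E by rewrite lee_fin Defs.normc_ge0.
have [J0 hJ] := esum_tail f0 fy e0; exists J0 => J /hJ lJ.
have cE : (\esum_(s in setT) (normc (cut J f s))%:E =
    \esum_(s in setT) (if s \in J then 0 else (normc (f s))%:E))%E.
  by apply: eq_esum => s _; rewrite /cut; case: ifP => // _; rewrite Normc.normc0.
rewrite partial_sumE -(conv_op_cut J fb).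
have c1 : ell1 (cut J f) by rewrite /ell1 cE; apply: lt_trans lJ _; rewrite ltry.
apply: le_lt_trans (rnorm_conv_op (conv_bounded_ell1 c1)) _.
rewrite cE -lte_fin fineK// ge0_fin_numE ?(lt_trans lJ) ?ltry//.
by apply: esum_ge0 => s _; case: ifP.
Qed.

Lemma sqsum_cut f (e : R) : (sqsum f < +oo)%E -> 0 < e ->
  exists J : {fset G}, l2norm (cut J f) < e.
Proof.
move=> fy e0; have e2 : 0 < e ^+ 2 by rewrite exprn_gt0.
have f0 s : (0 <= (normc (f s) ^+ 2)%:E)%E by rewrite lee_fin sqr_ge0.
have [J hJ] := esum_tail f0 fy e2; exists J.
have {}hJ := hJ J (fsubset_refl _).
have cE : (sqsum (cut J f) =
    \esum_(s in setT) (if s \in J then 0 else (normc (f s) ^+ 2)%:E))%E.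
  apply: eq_esum => s _; rewrite /cut; case: ifP => // _.
  by rewrite Normc.normc0 expr0n.
rewrite -(@ltr_pXn2r _ 2)// ?nnegrE ?l2norm_ge0 ?ltW//.
by rewrite -lte_fin -sqsum_fin cE// (lt_trans hJ)// ltry.
Qed.

Lemma ell1_finsupp f (J : {fset G}) : (forall s, s \notin J -> f s = 0) -> ell1 f.
Proof.
move=> fJ; have f0 s : (0 <= (normc (f s))%:E)%E by rewrite lee_fin Defs.normc_ge0.
rewrite /ell1 (esum_fset_split J f0) sumEFin esum1 ?adde0 ?ltry// => s _.
by case: ifPn => // /fJ ->; rewrite Normc.normc0.
Qed.

Lemma ell1_linear (a : C) f g : ell1 f -> ell1 g -> ell1 (a *: f + g).
Proof. by move=> fy; apply: abs_summableD; exact: abs_summableZ. Qed.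

Lemma pmul_ell1 (u f : G -> C) : (forall s, normc (u s) <= 1) -> ell1 f ->
  ell1 (pmul u f).
Proof.
move=> u1; apply: le_lt_trans; apply: le_esum => s _; rewrite lee_fin.
by rewrite Normc.normcM ler_piMl ?Defs.normc_ge0.
Qed.

End Convolution.

(** * Multipliers supported on a set [E] with a Haagerup inequality *)

Lemma closure_rnormP (R : realType) (W : normedModType R[i]) (A : set W) (p : W) :
  closure A p <-> forall e : R, 0 < e -> exists2 q, A q & rnorm (p - q) < e.
Proof.
split=> [clA e e0|h U].
  have [q [Aq]] := clA _ (nbhsx_ballx p e%:C (ltac:(by rewrite ltcR))).
  by rewrite -ball_normE/= Defs.normE ltcR => pq; exists q.
move=> /nbhs_ballP[e e0 eU].
have eE : e = (complex.Re e)%:C.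
  by case: e e0 {eU} => a b; rewrite /= ltcE /= => /andP[/eqP -> _].
have e0' : 0 < complex.Re e by rewrite -ltcR -eE.
have [q Aq pq] := h _ e0'; exists q; split=> //; apply: eU.
by rewrite -ball_normE/= Defs.normE eE ltcR.
Qed.

Section Multiplier.
Variables (R : realType) (G : groupType).
Local Notation C := R[i].
Local Notation H := (ell2 R G).
Local Notation B := (bop H).
Local Notation normc := Normc.normc.

(** Haagerup's inequality with 3 as the square root of 9. *)
Lemma conv_bounded_pair_words (y : nat -> G) (tau : G -> nat * bool) :
  (forall i g, tau g <> (i, false) -> tau (y i * g)%g = (i, true)) ->
  forall f : G -> C, (forall s, ~ pair_words y s -> f s = 0) ->
  (sqsum f < +oo)%E -> conv_bounded f (3 * l2norm f).
Proof.
move=> pp f fE fy; split=> [|x]; first by rewrite mulr_ge0 ?l2norm_ge0.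
have n0 (z : G -> C) s : (0 <= (normc (z s))%:E)%E by rewrite lee_fin Defs.normc_ge0.
apply: le_trans (haagerup_inequality pp (n0 f) (n0 x) _) _.
  by move=> s /fE ->; rewrite Normc.normc0.
rewrite -!sqsumE (sqsum_fin fy) muleA -EFinM exprMn.
by rewrite (_ : 3 ^+ 2 = 9)//; ring.
Qed.

Variables (E : set G) (K : R) (u : G -> C).
Hypothesis E_bounded : forall f : G -> C, (forall s, ~ E s -> f s = 0) ->
  (sqsum f < +oo)%E -> conv_bounded f (K * l2norm f).
Hypothesis K0 : 0 <= K.
Hypothesis u1 : forall s, normc (u s) <= 1.
Hypothesis uE : forall s, ~ E s -> u s = 0.

Let pmulE (v : G -> C) s : ~ E s -> pmul u v s = 0.
Proof. by move=> /uE us; rewrite /pmul us mul0r. Qed.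

Lemma sqsum_pmul (v : G -> C) : (sqsum (pmul u v) <= sqsum v)%E.
Proof.
apply: le_sqsum => s.
by rewrite Normc.normcM ler_piMl ?Defs.normc_ge0.
Qed.

Lemma le_l2norm (f g : G -> C) : (sqsum f <= sqsum g)%E -> (sqsum g < +oo)%E ->
  l2norm f <= l2norm g.
Proof.
by move=> fg gy; apply: sqsum_le; [exact: l2norm_ge0|rewrite -sqsum_fin].
Qed.

Let pmul_fin (v : H) : (sqsum (pmul u v) < +oo)%E.
Proof. exact: le_lt_trans (sqsum_pmul v) (ell2_fin v). Qed.

Let pmul_bounded (v : H) : conv_bounded (pmul u v) (K * l2norm (pmul u v)).
Proof. by apply: E_bounded; [exact: pmulE|exact: pmul_fin]. Qed.

(** Truncations of [f] to finite sets lie in ell^1 and approximate in operator norm: the tail is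
    still supported on [E], so its ell^2 norm controls it. *)
Lemma Cred_conv_op (f : G -> C) : (forall s, ~ E s -> f s = 0) ->
  (sqsum f < +oo)%E -> Cred R G (conv_op f).
Proof.
move=> fE fy; apply/closure_rnormP => e e0.
have fb := E_bounded fE fy.
(* [K + 1] instead of [K], which may be 0. *)
have e0' : 0 < e / (K + 1) by rewrite divr_gt0// ltr_wpDl.
have [J lJ] := sqsum_cut fy e0'.
pose g s := if s \in J then f s else 0.
have gJ s : s \notin J -> g s = 0 by rewrite /g => /negPf ->.
exists (lambda0 g); first by exists g => //; exact: ell1_finsupp gJ.
rewrite (lambda0E (ell1_finsupp gJ)) (conv_op_finsupp gJ).
rewrite (_ : \sum_(s <- J) _ = \sum_(s <- J) f s *: lreg R s); last first.
  by rewrite big_seq [RHS]big_seq; apply: eq_bigr => s; rewrite /g => ->.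
rewrite -(conv_op_cut J fb).
have cy : (sqsum (cut J f) < +oo)%E.
  apply: le_lt_trans fy; apply: le_sqsum => s; rewrite /cut; case: ifP => // _.
  by rewrite Normc.normc0 Defs.normc_ge0.
have cb : conv_bounded (cut J f) (K * l2norm (cut J f)).
  by apply: E_bounded => // s /fE; rewrite /cut; case: ifP.
apply: le_lt_trans (rnorm_conv_op cb) _.
apply: (@le_lt_trans _ _ (K * (e / (K + 1)))).
  by rewrite ler_wpM2l// ltW.
by rewrite mulrCA gtr_pMr// ltr_pdivrMr ?mul1r ?ltrDl ?ltr_wpDl.
Qed.

(** The vector [T delta_1] is the symbol of [T], namely [f] when [T = lambda0 f]. The formula is
    meaningful for every bounded [T]. *)
Definition mult_op (T : B) : B := conv_op (pmul u (T (ell2_delta R 1%g))).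

Lemma pmul_bop (a : C) (S T : B) (x : H) :
  pmul u ((a *: S + T) x) = a *: pmul u (S x) + pmul u (T x).
Proof.
apply/funext => s; rewrite fct_linearE /pmul.
by rewrite bop_addE bop_scaleE ell2_addE ell2_scaleE mulrDr mulrCA.
Qed.

Lemma mult_op_linear (a : C) (S T : B) :
  mult_op (a *: S + T) = a *: mult_op S + mult_op T.
Proof.
rewrite /mult_op pmul_bop.
exact: conv_op_linear (pmul_bounded _) (pmul_bounded _).
Qed.

Lemma mult_op_bounded (T : B) : rnorm (mult_op T) <= K * rnorm T.
Proof.
apply: le_trans (rnorm_conv_op (pmul_bounded _)) _; rewrite ler_wpM2l//.
apply: le_trans (le_l2norm (sqsum_pmul _) (ell2_fin _)) _.
rewrite -rnorm_l2norm; apply: le_trans (opnormP _ _) _.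
by rewrite rnorm_delta mulr1.
Qed.

Lemma mult_op_lambda0 (f : G -> C) : ell1 f -> mult_op (lambda0 f) = lambda0 (pmul u f).
Proof.
move=> fy; rewrite (lambda0E (pmul_ell1 u1 fy)) (lambda0E fy) /mult_op.
congr conv_op; apply/funext => s; congr (_ * _).
by rewrite (conv_opE (conv_bounded_ell1 fy)) conv_delta1.
Qed.

Lemma mult_op_multiplier : is_multiplier_map u mult_op.
Proof.
split.
- move=> T _; apply: Cred_conv_op; [exact: pmulE|exact: pmul_fin].
- by move=> a S T _ _; exact: mult_op_linear.
- by exists K => T _; exact: mult_op_bounded.
- exact: mult_op_lambda0.
Qed.

Lemma mult_map_multiplier : is_multiplier_map u (mult_map u).
Proof. exact: (xgetPex _ (ex_intro _ _ mult_op_multiplier)). Qed.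

(** [mult_map u] is an unspecified solution of its requirements. It agrees with [mult_op] on the
    operators [lambda0 f], hence on their closure, as both maps are linear and bounded there. *)
Lemma mult_mapE (T : B) : Cred R G T -> mult_map u T = mult_op T.
Proof.
move=> CT; have [_ mlin [M mb] ml] := mult_map_multiplier.
have Cl f : ell1 f -> Cred R G (lambda0 f).
  by move=> fy; apply: subset_closure; exists f.
apply/eqP; rewrite -subr_eq0 -normr_eq0 Defs.normE; apply/eqP; congr (_%:C).
apply/eqP; rewrite eq_le rnorm_ge0 andbT; apply/ler_addgt0Pr => e e0; rewrite add0r.
(* The sum of the bounds of the two maps; the 1 ensures positivity. *)
have M0 : 0 < `|M| + K + 1 by rewrite ltr_wpDl// addr_ge0.
have [_ [f fy <-] Tf] := (closure_rnormP _ _).1 CT _ (divr_gt0 e0 M0).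
(* Linearity and boundedness of [mult_map u] are known only on [Cred], so the difference has to be
   placed there. *)
have CD : Cred R G ((-1) *: lambda0 f + T).
  apply/closure_rnormP => d d0.
  have [_ [g gy <-] Tg] := (closure_rnormP _ _).1 CT _ d0.
  exists (lambda0 ((-1) *: f + g)); first by exists ((-1) *: f + g) => //; exact: ell1_linear.
  have fb := conv_bounded_ell1 fy; have gb := conv_bounded_ell1 gy.
  rewrite (lambda0E (ell1_linear _ fy gy)) (conv_op_linear _ fb gb).
  by rewrite -(lambda0E fy) -(lambda0E gy) opprD addrACA subrr add0r.
have -> : mult_map u T - mult_op T =
    mult_map u ((-1) *: lambda0 f + T) - mult_op ((-1) *: lambda0 f + T).
  rewrite mlin//; last exact: Cl.
  by rewrite mult_op_linear ml// mult_op_lambda0// opprD addrACA subrr add0r.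
apply: le_trans (rnormD _ _) _.
have -> (S : B) : rnorm (- S) = rnorm S by rewrite /rnorm normrN.
apply: (@le_trans _ _ ((`|M| + K + 1) * rnorm ((-1) *: lambda0 f + T))).
  rewrite !mulrDl mul1r; apply: (@le_trans _ _ (`|M| * rnorm ((-1) *: lambda0 f + T)
     + K * rnorm ((-1) *: lambda0 f + T))); last by rewrite lerDl rnorm_ge0.
  apply: lerD; last exact: mult_op_bounded.
  by apply: le_trans (mb _ CD) _; rewrite ler_wpM2r ?rnorm_ge0 ?ler_norm.
by rewrite -ler_pdivlMl// mulrC scaleN1r addrC ltW.
Qed.

End Multiplier.

(** * Functions of A(G) on [E], and membership in [MA] *)

Section FourierMultiplier.
Variables (R : realType) (G : groupType).
Local Notation C := R[i].
Local Notation H := (ell2 R G).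
Local Notation B := (bop H).
Local Notation normc := Normc.normc.

Lemma normc_conj (z : C) : normc (z^*) = normc z.
Proof. by apply: complexI; rewrite -!Defs.normcE norm_conjC. Qed.

Lemma coefE (x y : H) s : coef x y s = csum (fun t => x (s^-1 * t)%g * (y t)^*).
Proof. by []. Qed.

(** [v] is the coefficient of its reflection against [delta 1]: translating the reflection by [s]
    and evaluating at 1 gives [v s]. *)
Lemma fourier_algebra_ell2 (v : G -> C) : (sqsum v < +oo)%E -> fourier_algebra v.
Proof.
move=> vy; pose x s := v (s^-1)%g.
have xl2 : x \in l2pred (G := G).
  apply/asboolP; rewrite (_ : sqsum x = sqsum v)//.
  rewrite [RHS](@esum_bij _ _ _ _ (fun s => s^-1)%g)//.
  by exists (fun s => s^-1)%g => s; exact: invgK.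
exists (Ell2 xl2), (ell2_delta R 1%g); apply/funext => s.
rewrite coefE (@csum_single _ _ _ 1%g).
  by rewrite /= /x /delta eqxx mulg1 invgK rmorph1 mulr1.
by move=> t /negPf t1; rewrite /= /delta t1 rmorph0 mulr0.
Qed.

Variables (E : set G) (K : R) (u : G -> C).
Hypothesis E_bounded : forall f : G -> C, (forall s, ~ E s -> f s = 0) ->
  (sqsum f < +oo)%E -> conv_bounded f (K * l2norm f).
Hypothesis u1 : forall s, normc (u s) <= 1.
Hypothesis uE : forall s, ~ E s -> u s = 0.

(* Duality: the sum of |v|^2 over a finite subset of E is the pairing of v with
   a function supported on E. *)
Lemma sqsum_coef (x y : H) (v := coef x y) :
  (sqsum (fun s => if `[< E s >] then v s else 0%R) <=
   (K ^+ 2 * l2norm x ^+ 2 * l2norm y ^+ 2)%:E)%E.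
Proof.
apply: esum_le_fin => J.
pose f s := if (s \in J) && `[< E s >] then v s else 0.
have f0 s : (0 <= (normc (f s) ^+ 2)%:E)%E by rewrite lee_fin sqr_ge0.
have fE s : ~ E s -> f s = 0 by move=> /asboolPn nE; rewrite /f (negPf nE) andbF.
have fJ s : s \notin J -> f s = 0 by move=> /negPf sJ; rewrite /f sJ.
have fS : sqsum f = (\sum_(s <- J) normc (f s) ^+ 2)%:E.
  rewrite /sqsum (esum_fset_split J f0) sumEFin esum1 ?adde0// => s _.
  by case: ifPn => // /fJ ->; rewrite Normc.normc0 expr0n.
have fy : (sqsum f < +oo)%E by rewrite fS ltry.
rewrite (_ : (\sum_(s <- J) _)%E = sqsum f); last first.
  rewrite fS -sumEFin big_seq [RHS]big_seq; apply: eq_bigr => s sJ.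
  by rewrite /f sJ.
have n0 (z : G -> C) s : (0 <= (normc (z s))%:E)%E by rewrite lee_fin Defs.normc_ge0.
have [_ /(_ x) fb] := E_bounded fE fy.
(* On the support of [f] one has [f = v]; bounding one factor [|v s|] by its defining sum and
   exchanging sums pairs [|f| * |x|] with [|y|]. *)
have fpair : (sqsum f <= \esum_(t in setT) absconv f x t * (normc (y t))%:E)%E.
  apply: (@le_trans _ _ (\esum_(s in setT) \esum_(t in setT)
      (normc (f s))%:E * ((normc (x (s^-1 * t)%g))%:E * (normc (y t))%:E))%E).
    apply: le_esum => s _; rewrite esumZl//; last by move=> t; rewrite mule_ge0.
    rewrite expr2 EFinM; apply: lee_pmul => //.
    have [/andP[_ _]|nJ] := boolP ((s \in J) && `[< E s >]); last first.
      by rewrite /f (negPf nJ) Normc.normc0; apply: esum_ge0 => t _; rewrite mule_ge0.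
    rewrite /f; case: ifP => _; last first.
      by rewrite Normc.normc0; apply: esum_ge0 => t _; rewrite mule_ge0.
    rewrite /v coefE; apply: le_trans (normc_csum_le _) _; apply: le_esum => t _.
    by rewrite Normc.normcM normc_conj EFinM.
  rewrite exchange_esum; last by move=> s t; rewrite !mule_ge0.
  apply: le_esum => t _; rewrite -esumZr//; last by move=> s; rewrite mule_ge0.
  by apply: le_esum => s _; rewrite muleA.
(* This bounds the fourth power of the norm of [f] by its square times a constant; dividing by the
   square gives a bound independent of [J]. *)
have sq : (sqsum f ^+ 2 <= (((K * l2norm f) ^+ 2)%:E * sqsum x) * sqsum y)%E.
  apply: (@le_trans _ _ ((\esum_(t in setT) absconv f x t * (normc (y t))%:E) ^+ 2)%E).
    by rewrite !expe2; apply: lee_pmul => //; exact: sqsum_ge0.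
  apply: le_trans (esum_cauchy_schwarz (absconv_ge0 f x) (n0 y)) _.
  rewrite -sqsumE; apply: lee_pmul => //; last exact: sqsum_ge0.
  by apply: esum_ge0 => t _; rewrite expe2 sqre_ge0.
move: sq; rewrite (sqsum_fin fy) !(sqsum_fin (ell2_fin _)) -EFin_expe -!EFinM !lee_fin.
have := l2norm_ge0 f; move: (l2norm f) => a a0.
have [->|an0] := eqVneq a 0.
  by move=> _; rewrite expr0n/=; apply: mulr_ge0; [apply: mulr_ge0|]; exact: sqr_ge0.
have {an0}a0 : 0 < a ^+ 2 by rewrite exprn_gt0// lt0r an0.
move=> h; rewrite -(ler_pM2l a0) -expr2; apply: le_trans h _.
by rewrite le_eqVlt; apply/orP; left; apply/eqP; ring.
Qed.

Lemma MA_supported : MA R G u.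
Proof.
move=> v [x [y ->]]; apply: fourier_algebra_ell2.
apply: le_lt_trans (_ : _ <= (K ^+ 2 * l2norm x ^+ 2 * l2norm y ^+ 2)%:E)%E _.
  apply: le_trans (sqsum_coef x y); apply: le_sqsum => s; rewrite /pmul.
  case: asboolP => [_|/uE ->]; last by rewrite mul0r.
  by rewrite Normc.normcM ler_piMl ?Defs.normc_ge0.
by rewrite ltry.
Qed.

End FourierMultiplier.

(** * Compactness through the topology of pointwise convergence *)

Lemma continuous_sum_sqr (R : realType) (T : topologicalType) (I : Type) (r : seq I)
    (f g : I -> T -> R) (c d : I -> R) :
  (forall i, continuous (f i)) -> (forall i, continuous (g i)) ->
  continuous (fun t => \sum_(i <- r) ((f i t - c i) ^+ 2 + (g i t - d i) ^+ 2)).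
Proof.
move=> cf cg t; pose h i t := (f i t - c i) ^+ 2 + (g i t - d i) ^+ 2.
rewrite -/(h _ _); elim: r => [|i r IH].
  have -> : (fun t => \sum_(i <- [::]) h i t) = cst 0.
    by apply/funext => x; rewrite big_nil.
  exact: cst_continuous.
have -> : (fun t => \sum_(j <- i :: r) h j t) = fun t => h i t + \sum_(j <- r) h j t.
  by apply/funext => x; rewrite big_cons.
have sq (k : T -> R) e : continuous k -> {for t, continuous (fun t => (k t - e) ^+ 2)}.
  move=> ck; have kc : (fun t => k t - e) @ t --> k t - e.
    by apply: cvgB; [exact: ck|exact: cvg_cst].
  exact: (cvgM kc kc).
exact: (cvgD (cvgD (sq _ _ (cf i)) (sq _ _ (cg i))) IH).
Qed.

Section CompactMultiplier.
Variables (R : realType) (G : groupType).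
Local Notation C := R[i].
Local Notation H := (ell2 R G).
Local Notation B := (bop H).
Local Notation normc := Normc.normc.
(** Complex functions in real coordinates, [true] for real and [false] for imaginary parts, so that
    Tychonoff's theorem applies to real segments. *)
Local Notation coords := {ptws (G * bool) -> R}.

Definition dist2 (b : coords) (J : seq G) (a : coords) : R :=
  \sum_(s <- J) ((a (s, true) - b (s, true)) ^+ 2 +
                 (a (s, false) - b (s, false)) ^+ 2).

Lemma continuous_dist2 b J : continuous (dist2 b J).
Proof.
have cproj i : continuous (fun a : coords => a i).
  exact: (@proj_continuous (G * bool)%type (fun=> R) i).
exact: continuous_sum_sqr (fun s => cproj (s, true)) (fun s => cproj (s, false)).
Qed.

Definition complex_of_coords (a : coords) : G -> C :=
  fun s => Complex (a (s, true)) (a (s, false)).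

Let normc_sqr (x y : R) : normc (Complex x y) ^+ 2 = x ^+ 2 + y ^+ 2.
Proof. by rewrite /= sqr_sqrtr// addr_ge0 ?sqr_ge0. Qed.

Let D : set coords :=
  [set a | (sqsum (complex_of_coords a) <= 1)%E].

(** The unit ball of ell^2 is an intersection of closed conditions, each on finitely many
    coordinates. *)
Let closedD : closed D.
Proof.
pose D_ (J : {fset G}) : set coords := [set a | dist2 (fun=> 0) J a <= 1].
have -> : D = \bigcap_(J in setT) D_ J.
  apply/seteqP; split => a /= aD.
    move=> J _; rewrite /D_ /= /dist2; under eq_bigr do rewrite !subr0 -normc_sqr.
    rewrite -lee_fin -sumEFin; apply: le_trans aD.
    exact: (@esum_ge_fset R G (fun s => (normc (complex_of_coords a s) ^+ 2)%:E)).
  apply: esum_le_fin => J; have := aD J Logic.I; rewrite /D_ /= /dist2.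
  by rewrite sumEFin lee_fin; under eq_bigr do rewrite !subr0 -normc_sqr.
apply: closed_bigI => J _.
have /continuous_closedP := @continuous_dist2 (fun=> 0) J.
by move=> /(_ [set x | x <= 1]); apply; exact: closed_le.
Qed.

(** A closed subset of the cube with sides [[-1, 1]], which is compact by Tychonoff's theorem. *)
Let compactD : compact D.
Proof.
have cube : @compact coords [set a | forall i, `[-1, 1]%classic (a i)].
  apply: (@tychonoff (G * bool)%type (fun=> R) (fun=> `[-1, 1]%classic)) => i.
  exact: segment_compact.
apply: (subclosed_compact closedD cube) => a aD [s b] /=; rewrite in_itv/= -ler_norml.
have : normc (complex_of_coords a s) ^+ 2 <= 1.
  by rewrite -lee_fin; apply: le_trans aD; exact: sqsum_point.
rewrite normc_sqr => h.
rewrite -(@ler_pXn2r _ 2)// ?nnegrE// expr1n real_normK ?num_real//.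
by apply: le_trans h; case: b; rewrite ?lerDl ?lerDr sqr_ge0.
Qed.

Variables (E : set G) (K : R) (u : G -> C).
Hypothesis E_bounded : forall f : G -> C, (forall s, ~ E s -> f s = 0) ->
  (sqsum f < +oo)%E -> conv_bounded f (K * l2norm f).
Hypothesis K0 : 0 <= K.
Hypothesis u1 : forall s, normc (u s) <= 1.
Hypothesis uE : forall s, ~ E s -> u s = 0.
Hypothesis u_c0 : forall e : R, 0 < e ->
  exists J : {fset G}, forall s, s \notin J -> normc (u s) ^+ 2 <= e.

Let Phi (a : coords) : B := conv_op (pmul u (complex_of_coords a)).

Let bounded_pmul (g : G -> C) : (sqsum g < +oo)%E ->
  conv_bounded (pmul u g) (K * l2norm (pmul u g)).
Proof.
move=> gy; apply: E_bounded; first by move=> s /uE us; rewrite /pmul us mul0r.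
exact: le_lt_trans (sqsum_pmul u1 _) gy.
Qed.

Let fin_D a : D a -> (sqsum (complex_of_coords a) < +oo)%E.
Proof. by move=> /le_lt_trans; apply; rewrite ltry. Qed.

(** Split at [J]: inside, [|u| <= 1] leaves the distance on finitely many coordinates; outside,
    [|u|^2 <= e], and two points of the unit ball are at squared distance at most 4. *)
Let Phi_dist (a b : coords) (J : {fset G}) (e : R) : 0 <= e -> D a -> D b ->
  (forall s, s \notin J -> normc (u s) ^+ 2 <= e) ->
  rnorm (Phi b - Phi a) <= K * Num.sqrt (dist2 b J a + e * 4).
Proof.
move=> e0 aD bD uJ.
pose h := (-1 : C) *: complex_of_coords b + complex_of_coords a.
have hs s : normc (h s) ^+ 2 =
    (a (s, true) - b (s, true)) ^+ 2 + (a (s, false) - b (s, false)) ^+ 2.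
  rewrite -normc_sqr /h fct_linearE mulN1r; congr (normc _ ^+ 2).
  by rewrite /complex_of_coords; apply/eqP; rewrite eq_complex /= ![- _ + _]addrC !eqxx.
have h4 : (sqsum h <= 4%:E)%E.
  apply: le_trans (sqsumDt _ _ ltr01) _; rewrite sqsumZ invr1.
  have -> : normc (-1 : C) = 1 by rewrite -rnorm_normc /rnorm normrN normr1.
  rewrite expr1n mul1e.
  apply: (@le_trans _ _ ((1 + 1)%:E * 1 + (1 + 1)%:E * 1)%E).
    by apply: leeD; apply: lee_pmul; rewrite ?sqsum_ge0 ?lee_fin ?addr_ge0.
  by rewrite !mule1 -EFinD lee_fin; lra.
have hy : (sqsum h < +oo)%E by apply: le_lt_trans h4 _; rewrite ltry.
have -> : Phi b - Phi a = - conv_op (pmul u h).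
  rewrite (_ : pmul u h = (-1) *: pmul u (complex_of_coords b) + pmul u (complex_of_coords a)).
    rewrite (conv_op_linear _ (bounded_pmul (fin_D bD)) (bounded_pmul (fin_D aD))).
    by rewrite scaleN1r opprD opprK.
  by apply/funext => s; rewrite fct_linearE /pmul /h fct_linearE mulrDr mulrCA.
rewrite (_ : rnorm (- _) = rnorm (conv_op (pmul u h))); last by rewrite /rnorm normrN.
apply: le_trans (rnorm_conv_op (bounded_pmul hy)) _; rewrite ler_wpM2l//.
have d0 : 0 <= dist2 b J a by apply: sumr_ge0 => s _; rewrite addr_ge0 ?sqr_ge0.
apply: sqsum_le; first exact: sqrtr_ge0.
rewrite sqr_sqrtr ?addr_ge0 ?mulr_ge0//.
rewrite /sqsum (esum_fset_split J) => [|s]; last by rewrite lee_fin sqr_ge0.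
rewrite EFinD; apply: leeD.
  rewrite sumEFin lee_fin; apply: ler_sum => s _; rewrite -hs Normc.normcM exprMn.
  by rewrite ler_piMl ?sqr_ge0// exprn_ile1 ?Defs.normc_ge0.
apply: (@le_trans _ _ (e%:E * sqsum h)%E); last first.
  by rewrite EFinM; apply: lee_pmul => //; exact: sqsum_ge0.
rewrite /sqsum -esumZl ?lee_fin// => [|s]; last by rewrite lee_fin sqr_ge0.
apply: le_esum => s _; case: ifPn => sJ.
  by rewrite mule_ge0 ?lee_fin ?sqr_ge0.
by rewrite -EFinM lee_fin Normc.normcM exprMn ler_wpM2r ?sqr_ge0 ?uJ.
Qed.

Let continuous_Phi : {within D, continuous Phi}.
Proof.
apply/subspace_continuousP => b bD; apply/cvgrPdist_lt => e' e0.
have [e eE] : exists e : R, e' = e%:C.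
  by case: e' e0 => x y; rewrite ltcE /= => /andP[/eqP -> _]; exists x.
move: e0; rewrite {e'}eE ltcR => e0.
(* One share [d] for the coordinates in [J] and four for the tail. *)
pose d := (e / (K + 1)) ^+ 2 / 5.
have K1 : 0 < K + 1 by rewrite ltr_wpDl.
have d0 : 0 < d by rewrite divr_gt0// exprn_gt0// divr_gt0.
have [J uJ] := u_c0 d0.
have : \forall a \near (b : coords), dist2 b J a < d.
  have := @continuous_dist2 b J b; rewrite /continuous_at.
  move=> /cvgrPdist_lt/(_ _ d0); apply: filterS => a; rewrite distrC.
  rewrite (_ : dist2 b J b = 0) ?subr0; first exact: le_lt_trans (ler_norm _).
  by rewrite /dist2 big1// => s _; rewrite !subrr expr0n addr0.
move=> nd; rewrite near_withinE; apply: filterS nd => a ad aD.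
rewrite Defs.normE ltcR; apply: le_lt_trans (Phi_dist (ltW d0) aD bD uJ) _.
have e1 : Num.sqrt (dist2 b J a + d * 4) <= e / (K + 1).
  have e'0 : 0 <= e / (K + 1) by rewrite ltW// divr_gt0.
  rewrite -[leRHS]ger0_norm// -sqrtr_sqr ler_wsqrtr//.
  apply: (@le_trans _ _ (d + d * 4)); first by rewrite lerD2r ltW.
  by rewrite /d; lra.
apply: (@le_lt_trans _ _ (K * (e / (K + 1)))); first by rewrite ler_wpM2l.
by rewrite mulrCA gtr_pMr// ltr_pdivrMr ?mul1r ?ltrDl.
Qed.

Lemma compact_mult_map : compact_on (Cred R G) (mult_map u).
Proof.
apply: (@precompact_subset _ _ (Phi @` D)); last first.
  apply: compact_precompact; first exact: norm_hausdorff.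
  exact: (continuous_compact continuous_Phi compactD).
move=> _ [T [CT T1] <-].
rewrite (mult_mapE E_bounded K0 u1 uE CT) /mult_op.
set v := T _.
pose a : coords := fun p => if p.2 then complex.Re (v p.1) else complex.Im (v p.1).
have av : complex_of_coords a = v.
  by apply/funext => s; rewrite /complex_of_coords /a/=; case: (v s).
exists a; last by rewrite /Phi av.
rewrite /D /= av (sqsum_fin (ell2_fin v)) lee_fin expr_le1// ?l2norm_ge0//.
rewrite -rnorm_l2norm; apply: le_trans (opnormP _ _) _.
by rewrite rnorm_delta mulr1.
Qed.

End CompactMultiplier.

(** * Walsh matrices and the decaying weight *)

Section WalshMatrix.
Variable R : realType.

(** The Sylvester-Hadamard matrix: the sign is the parity of the number of common binary digits 1
    among the lowest [k]. *)
Fixpoint walsh_rec (k i j : nat) : R :=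
  if k is k'.+1 then (-1) ^+ (odd i && odd j) * walsh_rec k' i./2 j./2 else 1.

(** [i + j] digits suffice for both indices, so each leading block of size [2 ^ k] is the Walsh
    matrix of that order. *)
Definition walsh i j := walsh_rec (i + j) i j.

Lemma walsh_rec00 k : walsh_rec k 0 0 = 1.
Proof. by elim: k => //= k IH; rewrite expr0 mul1r. Qed.

Lemma walsh_recS k l i j : (i < 2 ^ k)%N -> (j < 2 ^ k)%N ->
  walsh_rec (k + l) i j = walsh_rec k i j.
Proof.
elim: k i j => [|k IH] i j.
  by rewrite expn0 !ltnS !leqn0 => /eqP-> /eqP->; rewrite walsh_rec00.
rewrite expnS mul2n => ik jk /=; congr (_ * _).
by apply: IH; rewrite ltn_half_double.
Qed.

Lemma walshE k i j : (i < 2 ^ k)%N -> (j < 2 ^ k)%N -> walsh i j = walsh_rec k i j.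
Proof.
move=> ik jk; rewrite -(walsh_recS (i + j) ik jk) addnC walsh_recS//.
  by rewrite (leq_ltn_trans (leq_addr j i))// ltn_expl.
by rewrite (leq_ltn_trans (leq_addl i j))// ltn_expl.
Qed.

Lemma walsh_rec_sqr k i j : walsh_rec k i j ^+ 2 = 1.
Proof.
by elim: k i j => [|k IH] i j /=; rewrite ?expr1n// exprMn IH mulr1 sqrr_sign.
Qed.

Lemma sum_double (F : nat -> R) n :
  \sum_(0 <= i < n.*2) F i = \sum_(0 <= i < n) (F i.*2 + F i.*2.+1).
Proof.
elim: n => [|n IH]; first by rewrite !big_geq.
by rewrite doubleS !big_nat_recr//= IH addrA.
Qed.

(** Rows are split by their lowest digit, which contributes [1 + (-1)^(j + j')]; the remaining
    digits give the induction hypothesis for the halves. *)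
Lemma walsh_rec_orthogonal k j j' : (j < 2 ^ k)%N -> (j' < 2 ^ k)%N ->
  \sum_(0 <= i < 2 ^ k) walsh_rec k i j * walsh_rec k i j' =
  if j == j' then (2 ^ k)%:R else 0.
Proof.
elim: k j j' => [|k IH] j j'.
  by rewrite expn0 !ltnS !leqn0 => /eqP-> /eqP->; rewrite big_nat1 mulr1.
rewrite expnS mul2n => jk jk'; rewrite sum_double.
under eq_bigr => i _.
  rewrite /= odd_double/= doubleK uphalf_double !expr0 !mul1r.
  rewrite mulrACA -[X in X + _]mul1r -mulrDl; over.
rewrite /= -mulr_sumr IH ?ltn_half_double//.
have jE : (j == j') = (j./2 == j'./2) && (odd j == odd j').
  apply/eqP/andP => [->//|[/eqP jh /eqP jo]].
  by rewrite -[j]odd_double_half -[j']odd_double_half jh jo.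
rewrite jE; case: eqP => _ /=; last by rewrite mulr0.
rewrite -addnn natrD; case: (odd j) (odd j') => -[] /=;
  rewrite ?expr0 ?expr1 ?mulrNN ?mulr1 ?mul1r; ring.
Qed.

Lemma walsh_orthogonal k (j j' : 'I_(2 ^ k)) :
  \sum_(i < 2 ^ k) walsh i j * walsh i j' = if j == j' then (2 ^ k)%:R else 0.
Proof.
rewrite -(walsh_rec_orthogonal (ltn_ord j) (ltn_ord j')) big_mkord.
by apply: eq_bigr => i _; rewrite !(@walshE k).
Qed.

Lemma orthogonal_sum_sqr (I : finType) (c : I -> I -> R) (b : I -> R) :
  (forall j j', \sum_i c i j * c i j' = (j == j')%:R) ->
  \sum_i (\sum_j c i j * b j) ^+ 2 = \sum_j b j ^+ 2.
Proof.
move=> cc; under eq_bigr do rewrite expr2 big_distrlr/=.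
rewrite exchange_big/=; apply: eq_bigr => j _; rewrite exchange_big/=.
rewrite (bigD1 j)//= [X in _ + X]big1 ?addr0 => [|j' jj'].

  transitivity ((\sum_i c i j * c i j) * b j ^+ 2); last by rewrite cc eqxx mul1r.
  by rewrite mulr_suml; apply: eq_bigr => i _; rewrite mulrACA expr2.
transitivity ((\sum_i c i j * c i j') * (b j * b j')).
  by rewrite mulr_suml; apply: eq_bigr => i _; rewrite mulrACA.
by rewrite cc eq_sym (negPf jj') mul0r.
Qed.

(** This is [(n + 1)^(-1/4)]: it tends to 0, which yields compactness, but so slowly that its
    product with [n^(1/2)] is unbounded. *)
Definition weight (n : nat) : R := Num.sqrt (Num.sqrt n.+1%:R^-1).

Lemma weight_ge0 n : 0 <= weight n. Proof. exact: sqrtr_ge0. Qed.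

Lemma weight_le m n : (m <= n)%N -> weight n <= weight m.
Proof.
move=> mn; rewrite !ler_wsqrtr//.
by rewrite lef_pV2 ?posrE// ler_nat ltnS.
Qed.

Lemma weight_sqr n : weight n ^+ 2 = Num.sqrt n.+1%:R^-1.
Proof. by rewrite sqr_sqrtr// sqrtr_ge0. Qed.

Lemma weight_le1 n : weight n <= 1.
Proof.
rewrite (le_trans (weight_le (leq0n n)))// /weight invr1 !sqrtr1//.
Qed.

Lemma weight_sqr_small (e : R) : 0 < e -> exists n, weight n ^+ 2 <= e.
Proof.
move=> e0; have e20 : 0 < e ^+ 2 by rewrite exprn_gt0.
exists (Num.truncn (e ^+ 2)^-1); rewrite weight_sqr.
rewrite -[leRHS]ger0_norm ?(ltW e0)// -sqrtr_sqr ler_wsqrtr//.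
by rewrite -[leRHS]invrK lef_pV2 ?posrE ?invr_gt0// ltW// truncnS_gt.
Qed.

End WalshMatrix.

(** * Norms of matrices of translation operators *)

Section NotCompletelyBounded.
Variables (R : realType) (G : groupType).
Local Notation C := R[i].
Local Notation H := (ell2 R G).
Local Notation B := (bop H).
Local Notation normc := Normc.normc.

Lemma rnorm_lreg s (x : H) : rnorm (lreg R s x) = rnorm x.
Proof. by rewrite !rnorm_l2norm /l2norm /= sqsum_shift. Qed.

Lemma lregM s s' (x : H) : lreg R (s * s')%g x = lreg R s (lreg R s' x).
Proof.
apply: ell2P => t; rewrite -[LHS]/(x ((s * s')^-1 * t)%g).
by rewrite -[RHS]/(x (s'^-1 * (s^-1 * t))%g) invgM mulgA.
Qed.

Lemma bopZ (T : B) (a : C) (x : H) : T (a *: x) = a *: T x.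
Proof. by rewrite linearZ. Qed.

Lemma lreg_delta (s r : G) : lreg R s (ell2_delta R r) = ell2_delta R (s * r)%g.
Proof.
apply: ell2P => t; rewrite -[LHS]/(delta R r (s^-1 * t)%g).
rewrite -[RHS]/(delta R (s * r)%g t) /delta; congr (if _ then _ else _).
by apply/eqP/eqP => [<-|->]; rewrite ?mulVKg ?mulKg.
Qed.

Lemma rnorm_sqr (x : H) : ((rnorm x ^+ 2)%:E = sqsum x)%E.
Proof. by rewrite rnorm_l2norm -sqsum_fin ?ell2_fin. Qed.

Lemma ell2_sumE (I : Type) (r : seq I) (x : I -> H) t :
  (\sum_(i <- r) x i) t = \sum_(i <- r) x i t.
Proof. by elim/big_rec2 : _ => // i a b _ <-. Qed.

Lemma complex_sum (I : Type) (r : seq I) (z : I -> C) :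
  \sum_(i <- r) z i =
  Complex (\sum_(i <- r) complex.Re (z i)) (\sum_(i <- r) complex.Im (z i)).
Proof.
by elim/big_rec3 : _ => // i a b c _ ->; case: (z i).
Qed.

Lemma normc_sqrE (z : C) : normc z ^+ 2 = complex.Re z ^+ 2 + complex.Im z ^+ 2.
Proof. by case: z => a b; rewrite /= sqr_sqrtr// addr_ge0 ?sqr_ge0. Qed.

Lemma orthogonal_sum_normc (I : finType) (c : I -> I -> R) (b : I -> C) :
  (forall j j', \sum_i c i j * c i j' = (j == j')%:R) ->
  \sum_i normc (\sum_j (c i j)%:C * b j) ^+ 2 = \sum_j normc (b j) ^+ 2.
Proof.
move=> cc; under [RHS]eq_bigr do rewrite normc_sqrE.
rewrite big_split/= -(orthogonal_sum_sqr (fun j => complex.Re (b j)) cc).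
rewrite -(orthogonal_sum_sqr (fun j => complex.Im (b j)) cc).
rewrite -big_split/=; apply: eq_bigr => i _. rewrite complex_sum normc_sqrE/=.
congr ((_) ^+ 2 + (_) ^+ 2); apply: eq_bigr => j _; case: (b j) => p q /=; ring.
Qed.

(** Squared norms are sums over the points of [G], and at each point [c] acts as an orthogonal
    matrix on a complex vector. *)
Lemma orthogonal_sum_rnorm (I : finType) (c : I -> I -> R) (x : I -> H) :
  (forall j j', \sum_i c i j * c i j' = (j == j')%:R) ->
  \sum_i rnorm (\sum_j (c i j)%:C *: x j) ^+ 2 = \sum_j rnorm (x j) ^+ 2.
Proof.
move=> cc.
have sE (z : I -> H) : ((\sum_i rnorm (z i) ^+ 2)%:E =
    \esum_(t in setT) (\sum_i normc (z i t) ^+ 2)%:E)%E.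
  rewrite -sumEFin; under eq_bigr do rewrite rnorm_sqr.
  rewrite -esum_sum; last by move=> t i _ _; rewrite lee_fin sqr_ge0.
  by apply: eq_esum => t _; rewrite sumEFin.
apply: EFin_inj; rewrite !sE; apply: eq_esum => t _; congr (_%:E).
rewrite -(orthogonal_sum_normc (fun j => x j t) cc); apply: eq_bigr => i _; congr (normc _ ^+ 2).
by rewrite ell2_sumE; apply: eq_bigr => j _; rewrite ell2_scaleE.
Qed.

(* Conjugating by the unitaries diag(lreg (y i)) turns an operator matrix
   [c i j *: lreg (y i * y j)] into the scalar matrix c. *)
Lemma bop_mxnorm_orthogonal m (c : 'I_m -> 'I_m -> R) (y : nat -> G) :
  (forall j j', \sum_i c i j * c i j' = (j == j')%:R) ->
  (bop_mxnorm H (\matrix_(i < m, j < m) ((c i j)%:C *: lreg R (y i * y j)%g)) <= 1)%E.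
Proof.
move=> cc; apply: ge_ereal_sup => _ [x /= x1 <-]; rewrite lee_fin.
apply: le_trans x1; rewrite /l2sum ler_wsqrtr//.
pose z (j : 'I_m) : H := lreg R (y j) (x j).
have -> : \sum_i rnorm (x i) ^+ 2 = \sum_i rnorm (z i) ^+ 2.
  by apply: eq_bigr => i _; rewrite rnorm_lreg.
rewrite -(orthogonal_sum_rnorm z cc) le_eqVlt; apply/orP; left; apply/eqP.
apply: eq_bigr => i _; congr (_ ^+ 2).
rewrite -[RHS](rnorm_lreg (y i)) linear_sum; congr (rnorm _).
by apply: eq_bigr => j _; rewrite mxE bop_scaleE lregM linearZ.
Qed.

(** Test on the unit vector with entries [m^(-1/2) delta_(y_j^-1)]: [lreg (y i * y j)] sends the
    j-th point mass to [delta_(y_i)], so row [i] adds up its coefficients. *)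
Lemma bop_mxnorm_lower m (c : 'I_m -> 'I_m -> R) (y : nat -> G) :
  (0 < m)%N ->
  ((Num.sqrt (m%:R^-1 * \sum_i (\sum_j c i j) ^+ 2))%:E <=
   bop_mxnorm H (\matrix_(i < m, j < m) ((c i j)%:C *: lreg R (y i * y j)%g)))%E.
Proof.
move=> m0; pose q : R := Num.sqrt m%:R^-1.
have q2 : q ^+ 2 = m%:R^-1 by rewrite sqr_sqrtr// invr_ge0.
pose x (j : 'I_m) : H := q%:C *: ell2_delta R (y j)^-1%g.
have xn j : rnorm (x j) = q.
  by rewrite rnormZ rnorm_delta mulr1 normcR ger0_norm// sqrtr_ge0.
apply: ereal_sup_ge; exists (l2sum (fun i => \sum_j
    (\matrix_(i < m, j < m) ((c i j)%:C *: lreg R (y i * y j)%g)) i j (x j)))%:E.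
  exists x => //=; rewrite /l2sum; under eq_bigr do rewrite xn q2.
  by rewrite sumr_const card_ord -[_ *+ _]mulr_natr mulVf ?sqrtr1// pnatr_eq0 -lt0n.
rewrite lee_fin /l2sum ler_wsqrtr// mulr_sumr; apply: ler_sum => i _.
have -> : \sum_j (\matrix_(i < m, j < m) ((c i j)%:C *: lreg R (y i * y j)%g)) i j (x j)
   = (q * \sum_j c i j)%:C *: ell2_delta R (y i).
  rewrite mulr_sumr rmorph_sum/= scaler_suml; apply: eq_bigr => j _.
  rewrite mxE bop_scaleE /x bopZ lreg_delta mulgK scalerA.
  by rewrite rmorphM mulrC.
by rewrite rnormZ rnorm_delta mulr1 normcR real_normK ?num_real// exprMn q2.
Qed.

End NotCompletelyBounded.

(** * The Walsh multiplier: decay and unbounded amplifications *)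

Section WalshMultiplier.
Variables (R : realType) (G : groupType) (y : nat -> G) (tau : G -> nat * bool).
Local Notation C := R[i].
Local Notation H := (ell2 R G).
Local Notation normc := Normc.normc.
Hypothesis pingpong :
  forall i g, tau g <> (i, false) -> tau (y i * g)%g = (i, true).

(** Well defined because a word determines its two letters. *)
Lemma pair_word_function (f : nat -> nat -> C) : exists u : G -> C,
  (forall i j, u (y i * y j)%g = f i j) /\ (forall s, ~ pair_words y s -> u s = 0).
Proof.
pose w s := xget (0%N, 0%N) [set e | s = (y e.1 * y e.2)%g].
exists (fun s => if `[< pair_words y s >] then f (w s).1 (w s).2 else 0).
split=> [i j|s /asboolPn/negPf -> //].
case: asboolP => [_|]; last by case; exists i, j.
rewrite /w; case: xgetP => [e _ /= /(pair_word_inj pingpong)[-> ->]//|].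
by move=> /(_ (i, j))[].
Qed.

Variable u : G -> C.
Hypothesis u_words : forall i j,
  u (y i * y j)%g = (weight R (maxn i j) * walsh R i j)%:C.
Hypothesis u0 : forall s, ~ pair_words y s -> u s = 0.

Lemma normc_walsh_word i j : normc (u (y i * y j)%g) ^+ 2 = weight R (maxn i j) ^+ 2.
Proof.
by rewrite u_words normcR real_normK ?num_real// exprMn walsh_rec_sqr mulr1.
Qed.

Lemma normc_walsh_le1 s : normc (u s) <= 1.
Proof.
have [[i [j ->]]|/u0 ->] := pselect (pair_words y s); last by rewrite Normc.normc0.
rewrite -(@ler_pXn2r _ 2)// ?nnegrE ?Defs.normc_ge0// normc_walsh_word.
by rewrite ler_pXn2r ?nnegrE ?weight_ge0 ?weight_le1.
Qed.

(** Outside the finitely many words with both indices below [n], the larger index is at least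
    [n]. *)
Lemma walsh_c0 (e : R) : 0 < e ->
  exists J : {fset G}, forall s, s \notin J -> normc (u s) ^+ 2 <= e.
Proof.
move=> e0; have [n ne] := weight_sqr_small e0.
pose L := [seq (y i * y j)%g | i <- iota 0 n, j <- iota 0 n].
exists [fset s in L]%fset => s; rewrite in_fset /= => sL.
have [[i [j sE]]|/u0 ->] := pselect (pair_words y s); last first.
  by rewrite Normc.normc0 expr0n ltW.
rewrite sE normc_walsh_word; apply: le_trans ne.
rewrite ler_pXn2r ?nnegrE ?weight_ge0// weight_le// leqNgt.
apply: contra sL; rewrite gtn_max => /andP[i_n j_n].
by rewrite sE; apply: allpairs_f; rewrite mem_iota.
Qed.

Variable S : bop H -> bop H.
Hypothesis S_mult : is_multiplier_map u S.

Lemma ell1_delta (a : C) (s : G) : ell1 (a *: delta R s).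
Proof.
apply: (@ell1_finsupp _ _ _ [fset s]%fset) => t; rewrite inE => /negPf ts.
by rewrite !fctE /delta ts scaler0.
Qed.

Lemma lambda0_delta (a : C) (s : G) : lambda0 (a *: delta R s) = a *: lreg R s.
Proof.
rewrite (lambda0E (ell1_delta a s)); apply: conv_op_unique => x t.
rewrite bop_scaleE ell2_scaleE /conv (@csum_single _ _ _ s).
  by rewrite !fctE /delta eqxx; congr (_ * _); rewrite [RHS]mulr1.
by move=> r /negPf rs; rewrite !fctE /delta rs scaler0 mul0r.
Qed.

Lemma S_lreg (a : C) (s : G) : S (a *: lreg R s) = (u s * a) *: lreg R s.
Proof.
have [_ _ _ Sl] := S_mult.
rewrite -lambda0_delta Sl; last exact: ell1_delta.
rewrite -lambda0_delta; congr lambda0; apply/funext => t; rewrite /pmul !fctE /delta.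
by case: eqP => [->|_]; rewrite ?scaler0 ?mulr0//; rewrite /GRing.scale /= mulrA.
Qed.

Lemma Cred_lreg (a : C) (s : G) : Cred R G (a *: lreg R s).
Proof.
apply: subset_closure; exists (a *: delta R s); first exact: ell1_delta.
exact: lambda0_delta.
Qed.

(** The test matrix is the normalized Walsh matrix with translations as entries. Applying [S]
    squares the signs away, so each row adds up [N] positive entries of size at least
    [N^(-1/4) N^(-1/2)]. *)
Lemma cb_norm_lower k :
  ((Num.sqrt (Num.sqrt (2 ^ k)%:R))%:E <=
   cb_norm (@bop_mxnorm R H) (@bop_mxnorm R H) (Cred R G) S)%E.
Proof.
set N := (2 ^ k)%N; have N0 : (0 < N)%N by rewrite expn_gt0.
have NR0 : 0 < N%:R :> R by rewrite ltr0n.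
pose r : R := Num.sqrt N%:R.
have r0 : 0 < r by rewrite sqrtr_gt0.
have r2 : r ^+ 2 = N%:R by rewrite sqr_sqrtr// ltW.
pose c (i j : 'I_N) : R := walsh R i j / r.
have cc j j' : \sum_i c i j * c i j' = (j == j')%:R.
  rewrite /c; under eq_bigr do rewrite mulrACA -invfM -expr2 r2.
  rewrite -mulr_suml walsh_orthogonal; case: eqP => _; last by rewrite mul0r.
  by rewrite mulfV// gt_eqF.
pose X : 'M[bop H]_N := \matrix_(i, j) ((c i j)%:C *: lreg R (y i * y j)%g).
pose d (i j : 'I_N) : R := weight R (maxn i j) * walsh R i j * c i j.
have SX : map_mx S X = \matrix_(i, j) ((d i j)%:C *: lreg R (y i * y j)%g).
  by apply/matrixP => i j; rewrite !mxE S_lreg u_words -rmorphM.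
apply: (@le_trans _ _ (bop_mxnorm H (map_mx S X))); last first.
  apply: ereal_sup_ubound; exists N, X; split=> //.
    by move=> i j; rewrite mxE; exact: Cred_lreg.
  exact: bop_mxnorm_orthogonal cc.
rewrite SX; apply: le_trans (bop_mxnorm_lower _ _ N0); rewrite lee_fin ler_wsqrtr//.
(* Indices stay at most [N - 1], where the decreasing weight is smallest; its value there is exactly
   [N^(-1/4)]. *)
have dge i j : weight R N.-1 / r <= d i j.
  rewrite /d /c mulrA -[_ * _ * walsh R i j]mulrA -expr2 walsh_rec_sqr mulr1.
  rewrite ler_pM2r ?invr_gt0// weight_le// -ltnS prednK// gtn_max.
  by rewrite !ltn_ord.
have wr : 0 <= weight R N.-1 / r by rewrite divr_ge0 ?weight_ge0// ltW.
have rowge i : r * weight R N.-1 <= \sum_j d i j.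
  apply: (@le_trans _ _ (\sum_(j < N) weight R N.-1 / r)).
    rewrite sumr_const card_ord -[_ *+ _]mulr_natl -r2 le_eqVlt.
    by apply/orP; left; apply/eqP; field; rewrite gt_eqF.
  by apply: ler_sum => j _; exact: dge.
apply: (@le_trans _ _ (N%:R^-1 * \sum_(i < N) (r * weight R N.-1) ^+ 2)); last first.
  apply: ler_wpM2l; first by rewrite invr_ge0 ltW.
  apply: ler_sum => i _.
  have rw : 0 <= r * weight R N.-1 by rewrite mulr_ge0 ?weight_ge0// ltW.
  by rewrite ler_pXn2r ?nnegrE// (le_trans rw).
rewrite sumr_const card_ord -[X in _ * X]mulr_natl mulKf ?gt_eqF//.
by rewrite exprMn weight_sqr prednK// (sqrtrV (ltW NR0)) -/r expr2 mulfK ?gt_eqF.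
Qed.

Lemma not_completely_bounded :
  ~ completely_bounded (@bop_mxnorm R H) (@bop_mxnorm R H) (Cred R G) S.
Proof.
rewrite /completely_bounded; have := cb_norm_lower; set n := cb_norm _ _ _ _.
case: n => [M| |]//; last by move=> /(_ 0%N); rewrite leeNy_eq.
(* Chosen so that [2 ^ k] exceeds [M ^ 4], whence its fourth root exceeds [M]. *)
move=> h _; pose k := (Num.truncn (M ^+ 4)).+1.
have Mk : M ^+ 4 < (2 ^ k)%:R.
  apply: lt_le_trans (truncnS_gt _) _; rewrite ler_nat ltnW// ltn_expl//.
have := h k; rewrite lee_fin leNgt => /negP; apply.
have M40 : 0 <= M ^+ 4 by rewrite (exprM M 2 2) sqr_ge0.
apply: le_lt_trans (ler_norm M) _.
rewrite -sqrtr_sqr ltr_sqrt ?sqrtr_gt0 ?ltr0n ?expn_gt0//.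
rewrite -[X in X < _]ger0_norm ?sqr_ge0// -sqrtr_sqr ltr_sqrt ?ltr0n ?expn_gt0//.
by rewrite -exprM.
Qed.

End WalshMultiplier.

Theorem proposition3p12 (R : realType) (G : groupType)
    (Gfree : contains_free_infty G) (GAP : has_AP R G) :
  exists u : G -> R[i],
    [/\ MA R G u,
        compact_on (Cred R G) (mult_map u) &
        ~ completely_compact (@bop_mxnorm R (ell2 R G)) (@bop_mxnorm R (ell2 R G))
            (Cred R G) (Cred R G) (mult_map u)].
Proof.
have [y [tau pingpong]] := contains_free_pingpong Gfree.
have E_bounded := @conv_bounded_pair_words R G y tau pingpong.
have [u [u_words u0]] := pair_word_function pingpong
  (fun i j => (weight R (maxn i j) * walsh R i j)%:C).
have u1 := normc_walsh_le1 u_words u0.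
have K0 : 0 <= 3 :> R by [].
exists u; split.
- exact: MA_supported E_bounded u1 u0.
- exact: compact_mult_map E_bounded K0 u1 u0 (walsh_c0 u_words u0).
(* Complete compactness contains complete boundedness, and that already fails. *)
- case=> cb _; apply: not_completely_bounded cb; first exact: u_words.
  exact: mult_map_multiplier E_bounded K0 u1 u0.
Qed.
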